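(* For every positive integer $d\le 95$, every very compressed ideal $I\subset \Bbbk[\alpha,\beta,\gamma]$ of colength $d$ is smoothable; that is, all points of $\mathcal{H}^{\max,d}$ lie in the smoothable component $R_3^d$ of the Hilbert scheme of $d$ points in $\mathbb{A}^3$.
   Context: The base field $\Bbbk$ is algebraically closed of characteristic zero. Let $T=\Bbbk[\alpha,\beta,\gamma]$ and let $\mathfrak{m}=(\alpha,\beta,\gamma)$ be the ideal of the origin of $\mathbb{A}^3=\operatorname{Spec}T$. An ideal $I\subset T$ with $\dim_{\Bbbk}T/I=d$ is called very compressed if $\mathfrak{m}^{s+1}\subset I\subset \mathfrak{m}^{s}$ for some integer $s\ge 0$; $\mathcal{H}^{\max,d}$ denotes the family of all very compressed ideals with $\dim_{\Bbbk}T/I=d$. $H_3^d$ denotes the Hilbert scheme of $d$ points in $\mathbb{A}^3$, whose closed points are the ideals $I\subset T$ with $\dim_{\Bbbk}T/I=d$. The smoothable component $R_3^d$ is the closure in $H_3^d$ of the open locus of ideals of smooth subschemes, i.e. of $d$ distinct reduced points; an ideal is smoothable if it is a point of $R_3^d$. *)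

(* Defs.v *)
From HB Require Import structures.
From mathcomp Require Import all_boot all_order all_algebra.
From mathcomp Require Import mpoly.

Set Implicit Arguments.
Unset Strict Implicit.
Unset Printing Implicit Defensive.

Import GRing.Theory.
Local Open Scope ring_scope.

Section Ideals.
Variable R : comNzRingType.

Definition ideal_span (S : R -> Prop) (f : R) : Prop :=
  exists (m : nat) (a g : 'I_m -> R),
    (forall i, S (g i)) /\ f = \sum_(i < m) a i * g i.

(* The empty product makes [ideal_pow S 0] the unit ideal. *)
Definition ideal_pow (S : R -> Prop) (s : nat) : R -> Prop :=
  ideal_span (fun g => exists h : 'I_s -> R,
    (forall i, S (h i)) /\ g = \prod_(i < s) h i).

End Ideals.

Section HilbertScheme.
Variables (k : fieldType) (n : nat).
Local Notation T := {mpoly k[n]}.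

Definition max_ideal : T -> Prop := ideal_span (fun g => exists i, g = 'X_i).

(* The classes of the B j form a k-basis of the quotient T / I. *)
Definition basis_mod (I : idealr T) (d : nat) (B : 'I_d -> T) : Prop :=
  forall f : T, exists! c : 'rV[k]_d, f - \sum_(j < d) c 0 j *: B j \in I.

Definition colength (I : idealr T) (d : nat) : Prop :=
  exists B : 'I_d -> T, basis_mod I B.

Definition very_compressed (I : idealr T) : Prop :=
  exists s : nat,
    (forall f, ideal_pow max_ideal s.+1 f -> f \in I) /\
    (forall f, f \in I -> ideal_pow max_ideal s f).

(* Closed points of the Hilbert scheme of d points in affine n-space.  For
   d > 0 there is no loss in [idealr] containing only proper ideals. *)
Record hilb (d : nat) := Hilb {
  hilb_ideal :> idealr T;
  hilb_colength : colength hilb_ideal d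
}.

(* The Hilbert scheme is covered by the affine open charts
     U_B = { I | B is a basis of T / I },   B : 'I_d -> T.
   The coordinate ring of U_B is generated by the functions sending I to the
   j-th coordinate, in the basis B, of the class of f in T / I, for f in T and
   j < d.  A [chart_fun] is a polynomial in these generators: row a of the
   matrix C in [chart_zero] holds the coordinates of [cf_arg a], and C is
   unique when I is in U_B. *)
Record chart_fun (d : nat) := ChartFun {
  cf_size : nat;
  cf_arg : 'I_cf_size -> T;
  cf_poly : {mpoly k[cf_size * d]}
}.

Definition chart_zero (d : nat) (B : 'I_d -> T) (r : chart_fun d)
    (I : idealr T) : Prop :=
  forall C : 'M[k]_(cf_size r, d),
    (forall a, cf_arg a - \sum_(j < d) C a j *: B j \in I) ->
    (cf_poly r).@[fun i => mxvec C 0 i] = 0.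

(* A set is Zariski closed when its trace on each chart is the zero locus of a
   set of regular functions on that chart. *)
Definition zariski_closed (d : nat) (Z : hilb d -> Prop) : Prop :=
  forall B : 'I_d -> T, exists E : chart_fun d -> Prop,
    forall I : hilb d, basis_mod I B ->
      (Z I <-> forall r, E r -> chart_zero B r I).

Definition zariski_closure (d : nat) (S : hilb d -> Prop) (I : hilb d) : Prop :=
  forall Z : hilb d -> Prop,
    zariski_closed Z -> (forall J, S J -> Z J) -> Z I.

(* Over an algebraically closed field the smooth subschemes of length d are
   the reduced unions of d distinct rational points. *)
Definition smooth_locus (d : nat) (I : hilb d) : Prop :=
  exists p : 'I_d -> 'rV[k]_n, injective p /\
    forall f : T, f \in hilb_ideal I <-> forall j, f.@[fun i => p j 0 i] = 0.

Definition smoothable_component (d : nat) : hilb d -> Prop :=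
  zariski_closure (@smooth_locus d).

End HilbertScheme.

(* Main.v *)
From HB Require Import structures.
Require Import Defs.
From mathcomp Require Import all_boot all_order all_algebra.
From mathcomp Require Import mpoly ring.

(** The smoothable component is closed, so a very compressed ideal [I], with
m^(s+1) contained in [I] and [I] in m^s, has to be exhibited as a limit of
ideals of distinct points.  Up to degree [s] such an [I] is nothing but a space
of forms of degree [s], of dimension [b = N - a], where [N] is the number of
monomials of degree [s], [L] the number of monomials of smaller degree and
[d = L + a] the colength.

Let [P] be [d] distinct points that impose independent conditions in degrees
below [s] and up to [s] as far as possible ([general_points]).  The polynomials
of degree at most [s] through [P] have leading forms that span a space [K0] of
dimension [b], and contracting [P] to the origin degenerates the ideal of [P]
to the very compressed ideal of [K0] ([cone_zero]).  The remaining condition in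
[general_points] says that the differential of [P |-> K0] is onto the tangent
space of the Grassmannian, whose points are all the very compressed ideals
with these [s] and [d].  Hence moving the points moves [K0] in every direction,
and as the Grassmannian is irreducible all of it consists of limits.

Instead of irreducibility, the proof uses a line.  The spaces [K0] and [K1], of
leading forms of [P] and of forms of [I], have a common complement [W]
([common_complement]), so that the line [K0 + t X W] joins them for some matrix
[X].  Newton's method ([curve_lift]) gives, for every [m], points [P(t)] with
coordinates polynomial in [t] whose leading forms agree with [K0 + t X W]
modulo [t^(m+1)].  A regular function of the chart that vanishes at all ideals
of distinct points, restricted to the line, is a polynomial in [t] divisible by
[t^(m+1)] for every [m] ([cone_limit_zero]).  It is zero, in particular at
[t = 1], where it is the value at [I].  This is [smoothable_of_general_points].

It remains to find general points.  They are taken with integer coordinates: the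
simplicial grid of exponents of degree less than [s] and [a] extra points.  On
the grid the polynomials of degree [s] that vanish are combinations of products
of falling factorials ([newton_expansion]) and the Lagrange polynomials are
explicit ([lagrange_grid]), so that generality becomes the injectivity of two
small systems of linear equations with integer coefficients
([grid_and_general]).  An integer matrix that is injective modulo a prime is
injective in characteristic zero ([injective_transfer]); Gaussian elimination
modulo 31 does the rest, for each of the pairs [(s, a)] with [L + a <= 95]
([certificates]).  A surjective differential needs [a * b <= 3 * d], and
[d = 96], where [s = 7], [a = 12] and [b = 24], leaves no room: there
[a * b = 3 * d] although translating the points does not change [K0]. *)

Set Implicit Arguments.
Unset Strict Implicit.
Unset Printing Implicit Defensive.

Import GRing.Theory.
Local Open Scope ring_scope.

(** * Linear algebra, polynomials and perturbations *)

Lemma sum_enum_val (V : nmodType) (R : finType) (F : R -> V) :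
  \sum_r F r = \sum_(i < #|R|) F (enum_val i).
Proof. by rewrite -big_enum_val. Qed.

(** A linear map is onto when its transpose is injective; conditions on points are
    stated as the absence of relations, and are used to solve equations. *)
Lemma linear_surj (k : fieldType) (R C : finType) (A : R -> C -> k) :
  (forall c : R -> k, (forall x, \sum_r c r * A r x = 0) -> forall r, c r = 0) ->
  forall y : R -> k, exists v : C -> k, forall r, \sum_x A r x * v x = y r.
Proof.
move=> inj y.
pose M := \matrix_(i < #|R|, j < #|C|) A (enum_val i) (enum_val j).
have /row_freeP[B MB] : row_free M.
  apply: inj_row_free => c cM.
  have c0 : forall r, c 0 (enum_rank r) = 0.
    apply: inj => x; have /matrixP/(_ 0 (enum_rank x)) := cM.
    rewrite !mxE => cMx; rewrite -[RHS]cMx sum_enum_val.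
    by apply: eq_bigr => i _; rewrite enum_valK !mxE !enum_rankK.
  by apply/rowP => i; rewrite mxE -(enum_valK i) c0.
pose w := B *m (\col_i y (enum_val i)).
exists (fun x => w (enum_rank x) 0) => r.
have /matrixP/(_ (enum_rank r) 0) : M *m w = \col_i y (enum_val i).
  by rewrite mulmxA MB mul1mx.
rewrite !mxE enum_rankK => <-; rewrite sum_enum_val.
by apply: eq_bigr => i _; rewrite enum_valK !mxE enum_rankK.
Qed.

Section Char0.
Variable k : fieldType.
Hypothesis char0 : [pchar k] =i pred0.

(** In characteristic zero 0, 1, 2, and so on are infinitely many candidates. *)
Lemma poly_nonroot (p : {poly k}) : p != 0 -> exists t, p.[t] != 0.
Proof.
move=> p0; have natE : forall n, (n%:R == 0 :> k) = (n == 0%N).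
  exact/pcharf0P.
have natI : injective (fun n => n%:R : k).
  have le_inj : forall m n : nat, (m <= n)%N -> m%:R = n%:R :> k -> m = n.
    move=> m n le_mn e; apply/eqP; rewrite eqn_leq le_mn /= -subn_eq0 -natE.
    by rewrite natrB // e subrr.
  by move=> m n e; case: (leqP m n) => [/le_inj|/ltnW/le_inj h]; [|rewrite h]; auto.
pose rs := [seq n%:R : k | n <- iota 0 (size p)].
case: (boolP (all (root p) rs)) => [all_rs|].
  have uniq_rs : uniq rs by rewrite map_inj_uniq ?iota_uniq.
  by have := max_poly_roots p0 all_rs uniq_rs; rewrite size_map size_iota ltnn.
by case/allPn => t _ nt; exists t.
Qed.

Lemma poly_eq0_off (d p : {poly k}) : d != 0 ->
  (forall t, d.[t] != 0 -> p.[t] = 0) -> p = 0.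
Proof.
move=> d0 p0; apply/eqP/negPn/negP => pn0.
have [t] := poly_nonroot (mulf_neq0 d0 pn0).
by rewrite hornerM mulf_eq0; case: eqP => //= /eqP dt; rewrite p0 ?eqxx.
Qed.

End Char0.

Lemma mpoly_ring_ind (R : comNzRingType) (n : nat) (Q : {mpoly R[n]} -> Prop) :
  (forall c, Q c%:MP) -> (forall i, Q 'X_i) ->
  (forall p q, Q p -> Q q -> Q (p + q)) -> (forall p q, Q p -> Q q -> Q (p * q)) ->
  forall p, Q p.
Proof.
move=> QC QX QD QM; elim/mpolyind => [|c m p _ _ Qp].
  by rewrite -mpolyC0; apply: QC.
apply: QD => //; rewrite -mul_mpolyC; apply: (QM) => //.
rewrite (mpolyXE_id); have Q1 : Q 1 by rewrite -mpolyC1; apply: QC.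
apply: (big_ind Q Q1 QM) => i _.
elim: (m _) => [|e IH]; first by rewrite expr0.
by rewrite exprS; apply: QM.
Qed.

Lemma horner_mmap (R : comNzRingType) (n : nat) (u : 'I_n -> {poly R}) (p : {mpoly R[n]}) t :
  (mmap polyC u p).[t] = p.@[fun i => (u i).[t]].
Proof.
elim/mpoly_ring_ind: p => [c|i|p q IHp IHq|p q IHp IHq].
- by rewrite mmapC mevalC hornerC.
- by rewrite mmapX mmap1U mevalXU.
- by rewrite !raddfD /= hornerD IHp IHq.
- by rewrite !rmorphM /= hornerM IHp IHq.
Qed.

(** First-order Taylor expansion, with a remainder whose form does not matter. *)
Lemma mmap_taylor (R : comNzRingType) (S : comNzRingType) (h : {rmorphism R -> S}) (n : nat) (x y : 'I_n -> S) (e : S)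
  (p : {mpoly R[n]}) :
  exists r, mmap h (fun i => x i + e * y i) p =
    mmap h x p + e * (\sum_i y i * mmap h x p^`M(i)) + e ^+ 2 * r.
Proof.
elim/mpoly_ring_ind: p => [c|i|p q [r IHp] [s IHq]|p q [r IHp] [s IHq]].
- exists 0; rewrite !mmapC big1 => [|i _]; first by ring.
  by rewrite mderivC mmap0 mulr0.
- exists 0; rewrite !mmapX !mmap1U (bigD1 i) //= big1 => [|j ji].
    rewrite mderivX mnm1E eqxx scale1r.
    have -> : ((U_(i) - U_(i))%MM = 0%MM :> 'X_{1..n}) by apply/mnmP => j; rewrite mnmBE mnm0E subnn.
    by rewrite mpolyX0 rmorph1; ring.
  rewrite mderivX mnm1E [i == j]eq_sym (negPf ji) scale0r mmap0; ring.
- exists (r + s); rewrite !raddfD /= IHp IHq.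
  under [in RHS]eq_bigr => i _ do rewrite mderivD raddfD /= mulrDr.
  rewrite big_split /=; ring.
- set a := mmap h x p in IHp; set b := mmap h x q in IHq.
  set A := \sum_i _ in IHp; set B := \sum_i _ in IHq.
  exists (A * B + a * s + b * r + e * (A * s + B * r) + e ^+ 2 * (r * s)).
  rewrite !rmorphM /= IHp IHq -/a -/b.
  have -> : \sum_i y i * mmap h x (p * q)^`M(i) = A * b + a * B.
    rewrite mulr_suml mulr_sumr -big_split; apply: eq_bigr => i _ /=.
    by rewrite mderivM rmorphD !rmorphM /= -/a -/b; ring.
  ring.
Qed.

Section Perturbation.
Variable k : fieldType.
Hypothesis char0 : [pchar k] =i pred0.

(** For [t] with [d.[t] != 0] both sides are equal before the term in ['X^m]; only
    the existence of the exponent [e] matters, which makes an induction on [H]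
    possible. *)
Lemma clear_denominators (N m : nat) (u v : 'I_N -> {poly k}) (d : {poly k}) (H : {mpoly k[N]}) :
  exists e q, forall t, d.[t] != 0 ->
    d.[t] ^+ e * H.@[fun i => (u i).[t] + t ^+ m * (v i).[t] / d.[t]] =
    (d ^+ e * mmap polyC u H + 'X^m * q).[t].
Proof.
elim/mpoly_ring_ind: H => [c|i|p q [e1 [q1 IH1]] [e2 [q2 IH2]]|p q [e1 [q1 IH1]] [e2 [q2 IH2]]].
- exists 0%N, 0 => t _; rewrite mevalC mmapC !hornerE; ring.
- exists 1%N, (v i) => t d0; rewrite mevalXU mmapX mmap1U !hornerE.
  by field.
- exists (e1 + e2)%N, (d ^+ e2 * q1 + d ^+ e1 * q2) => t d0.
  have := IH1 t d0; have := IH2 t d0; rewrite !raddfD /= !exprD !(hornerD, hornerM, horner_exp, hornerXn) => E2 E1.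
  rewrite [LHS](_ : _ = d.[t] ^+ e2 * (d.[t] ^+ e1 * p.@[fun i => (u i).[t] + t ^+ m * (v i).[t] / d.[t]])
     + d.[t] ^+ e1 * (d.[t] ^+ e2 * q.@[fun i => (u i).[t] + t ^+ m * (v i).[t] / d.[t]])); last by ring.
  by rewrite E1 E2; ring.
- exists (e1 + e2)%N, (d ^+ e1 * mmap polyC u p * q2 + q1 * (d ^+ e2 * mmap polyC u q + 'X^m * q2)) => t d0.
  have := IH1 t d0; have := IH2 t d0; rewrite !rmorphM /= !exprD !(hornerD, hornerM, horner_exp, hornerXn) => E2 E1.
  rewrite [LHS](_ : _ = (d.[t] ^+ e1 * p.@[fun i => (u i).[t] + t ^+ m * (v i).[t] / d.[t]])
     * (d.[t] ^+ e2 * q.@[fun i => (u i).[t] + t ^+ m * (v i).[t] / d.[t]])); last by ring.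
  by rewrite E1 E2; ring.
Qed.

(** Values that differ from the curve [u] by multiples of [t^m], with denominators
    that do not vanish at 0, change the value of [H] by a multiple of [t^m] only.
    So [H] need only vanish at rational perturbations of [u] for almost all [t]. *)
Lemma perturbation_dvd (N m : nat) (u v : 'I_N -> {poly k}) (d : {poly k}) (H : {mpoly k[N]}) :
  d.[0] != 0 ->
  (forall t, d.[t] != 0 -> H.@[fun i => (u i).[t] + t ^+ m * (v i).[t] / d.[t]] = 0) ->
  'X^m %| mmap polyC u H.
Proof.
move=> d0 H0; have [e [q E]] := clear_denominators m u v d H.
have dn0 : d != 0 by apply: contraNneq d0 => ->; rewrite horner0.
have cop : coprimep 'X^m (d ^+ e).
  by rewrite coprimep_expl ?coprimep_expr // coprimep_sym coprimepX.
rewrite -(Gauss_dvdpr _ cop).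
have : d ^+ e * mmap polyC u H + 'X^m * q = 0.
  by apply: (poly_eq0_off char0 dn0) => t dt; rewrite -E ?H0 ?mulr0.
by move/eqP; rewrite addr_eq0 => /eqP ->; rewrite dvdpNr dvdp_mulr.
Qed.

End Perturbation.

Lemma dvdXn_all (k : fieldType) (p : {poly k}) : (forall m, 'X^m %| p) -> p = 0.
Proof.
move=> Xp; apply/eqP/negPn/negP => p0.
by have := dvdp_leq p0 (Xp (size p)); rewrite size_polyXn ltnn.
Qed.

Section Complement.
Variable k : fieldType.
Hypothesis char0 : [pchar k] =i pred0.

Lemma complement_exists (a b : nat) (K : 'M[k]_(b, b + a)) :
  row_free K -> exists W : 'M_(a, b + a), col_mx K W \in unitmx.
Proof.
move=> /eqP rK; exists (dsubmx (row_ebase K)).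
have -> : col_mx K (dsubmx (row_ebase K)) = block_mx (col_ebase K) 0 0 1%:M *m row_ebase K.
  rewrite -[in RHS](vsubmxK (row_ebase K)) mul_block_col !mul0mx addr0 add0r mul1mx.
  congr col_mx; rewrite -{1}[K]mulmx_ebase rK -mulmxA; congr (_ *m _).
  by rewrite -{1}(vsubmxK (row_ebase K)) pid_mx_row mul_row_col mul1mx mul0mx addr0.
by rewrite unitmx_mul row_ebase_unit andbT unitmxE det_ublock det1 mulr1 -unitmxE col_ebase_unit.
Qed.

Lemma det_line (m : nat) (A B : 'M[k]_m) t :
  (\det (map_mx polyC A + 'X *: map_mx polyC B)).[t] = \det (A + t *: B).
Proof.
rewrite -[LHS]/(horner_eval t _) -det_map_mx; congr (\det _).
by apply/matrixP => i j; rewrite !mxE [LHS]/= /horner_eval !hornerE.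
Qed.

(** On the line from a complement of [K0] to a complement of [K1] the two
    determinants are nonzero polynomials in the parameter, and an infinite field
    contains a parameter at which neither vanishes. *)
Lemma common_complement (a b : nat) (K0 K1 : 'M[k]_(b, b + a)) :
  row_free K0 -> row_free K1 ->
  exists W : 'M_(a, b + a), (col_mx K0 W \in unitmx) && (col_mx K1 W \in unitmx).
Proof.
move=> /complement_exists[W0 u0] /complement_exists[W1 u1].
(* The restrictions of the determinants to the line from [W0] to [W1]. *)
pose D (K : 'M[k]_(b, b + a)) := \det (map_mx polyC (col_mx K W0) + 'X *: map_mx polyC (col_mx (0 : 'M_(b, _)) (W1 - W0))).
have DE K t : (D K).[t] = \det (col_mx K (W0 + t *: (W1 - W0))).
  by rewrite det_line scale_col_mx add_col_mx scaler0 addr0.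
have D0 : D K0 != 0.
  apply: contraTneq u0 => D0; have := DE K0 0; rewrite D0 horner0 scale0r addr0 unitmxE => <-.
  by rewrite unitr0.
have D1 : D K1 != 0.
  apply: contraTneq u1 => D1; have := DE K1 1; rewrite D1 horner0 scale1r addrC subrK unitmxE => <-.
  by rewrite unitr0.
have [t] := poly_nonroot char0 (mulf_neq0 D0 D1).
rewrite hornerM mulf_eq0 negb_or !DE => /andP[d0 d1].
by exists (W0 + t *: (W1 - W0)); rewrite !unitmxE !unitfE d0.
Qed.

End Complement.

(** * Ideals of points and graded pieces *)

Section Points.
Variables (k : fieldType) (n d : nat).
Hypothesis d_gt0 : (0 < d)%N.
Variable P : 'I_d -> 'I_n -> k.

(** The proof of [0 < d] is an argument because [idealr] contains proper ideals only,
    and the instance below has to be inferred from the term. *)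
Definition vanishing of (0 < d)%N : pred {mpoly k[n]} :=
  fun f => [forall j, f.@[P j] == 0].

Lemma vanishingP f : reflect (forall j, f.@[P j] = 0) (f \in vanishing d_gt0).
Proof. exact: 'forall_eqP. Qed.

Lemma vanishing_idealr : idealr_closed (vanishing d_gt0).
Proof.
split.
- by apply/vanishingP => j; rewrite meval0.
- apply/vanishingP => /(_ (Ordinal d_gt0)); rewrite meval1.
  by apply/eqP; rewrite oner_eq0.
- move=> c f g /vanishingP f0 /vanishingP g0; apply/vanishingP => j.
  by rewrite mevalD mevalM f0 g0 mulr0 addr0.
Qed.

End Points.

HB.instance Definition _ (k : fieldType) n d (d_gt0 : (0 < d)%N) (P : 'I_d -> 'I_n -> k) :=
  isIdealr.Build _ (vanishing P d_gt0) (vanishing_idealr d_gt0 P).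

Section Graded.
Variables (k : fieldType) (n s L N : nat).
Variables (low : 'I_L -> 'X_{1..n}) (top : 'I_N -> 'X_{1..n}).
Hypothesis low_inj : injective low.
Hypothesis top_inj : injective top.
Hypothesis low_codom : forall m, (m \in codom low) = (mdeg m < s)%N.
Hypothesis top_codom : forall m, (m \in codom top) = (mdeg m == s).
Local Notation T := {mpoly k[n]}.

Definition combination (M : nat) (e : 'I_M -> 'X_{1..n}) (u : 'rV[k]_M) : T :=
  \sum_i u 0 i *: 'X_[e i].

Definition coefs (M : nat) (e : 'I_M -> 'X_{1..n}) (f : T) : 'rV[k]_M :=
  \row_i f@_(e i).

Definition monomials_at (R : comNzRingType) (M d : nat) (e : 'I_M -> 'X_{1..n})
  (P : 'I_d -> 'I_n -> R) : 'M[R]_(M, d) := \matrix_(i, j) mmap1 (P j) (e i).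

Lemma combinationE M (e : 'I_M -> 'X_{1..n}) (u : 'rV[k]_M) : injective e ->
  forall i, (combination e u)@_(e i) = u 0 i.
Proof.
move=> e_inj i; rewrite raddf_sum (bigD1 i) //= big1 => [|j ji].
  by rewrite linearZ /= mcoeffX eqxx mulr1 addr0.
by rewrite linearZ /= mcoeffX (inj_eq e_inj) (negPf ji) mulr0.
Qed.

Lemma combination_out M (e : 'I_M -> 'X_{1..n}) (u : 'rV[k]_M) m :
  m \notin codom e -> (combination e u)@_m = 0.
Proof.
move=> em; rewrite raddf_sum big1 //= => i _; rewrite linearZ /= mcoeffX.
by case: eqP => [eim|_]; [rewrite -eim codom_f in em|rewrite mulr0].
Qed.

Lemma combinationD M (e : 'I_M -> 'X_{1..n}) : {morph combination e : u v / u + v}.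
Proof. by move=> u v; rewrite -big_split; apply: eq_bigr => i _; rewrite mxE scalerDl. Qed.

Lemma combinationZ M (e : 'I_M -> 'X_{1..n}) c u :
  combination e (c *: u) = c *: combination e u.
Proof. by rewrite scaler_sumr; apply: eq_bigr => i _; rewrite mxE scalerA. Qed.

Lemma combination_mul M (e : 'I_M -> 'X_{1..n}) m (c : 'rV_m) (A : 'M_(m, M)) :
  combination e (c *m A) = \sum_i c 0 i *: combination e (row i A).
Proof.
rewrite /combination; under [RHS]eq_bigr => i _ do rewrite scaler_sumr.
rewrite exchange_big; apply: eq_bigr => j _; rewrite mxE scaler_suml.
by apply: eq_bigr => i _; rewrite !mxE scalerA.
Qed.

Lemma meval_combination M (e : 'I_M -> 'X_{1..n}) d (P : 'I_d -> 'I_n -> k) u j :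
  (combination e u).@[P j] = (u *m monomials_at e P) 0 j.
Proof.
rewrite raddf_sum mxE; apply: eq_bigr => i _.
by rewrite /= mevalZ mxE /meval mmapX.
Qed.

Lemma tail_coef f m : (mdeg m <= s)%N ->
  (f - combination low (coefs low f) - combination top (coefs top f))@_m = 0.
Proof.
rewrite leq_eqVlt !mcoeffB => /orP[ms|ms].
  rewrite [X in _ - X - _]combination_out ?low_codom -?leqNgt ?(eqP ms) //.
  have : m \in codom top by rewrite top_codom.
  by case/codomP => i ->; rewrite combinationE // mxE subr0 subrr.
rewrite [X in _ - _ - X]combination_out ?top_codom ?(ltn_eqF ms) //.
have : m \in codom low by rewrite low_codom.
by case/codomP => i ->; rewrite combinationE // mxE subrr subr0.
Qed.

Lemma combination_low_size u : (msize (combination low u) <= s)%N.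
Proof.
apply: leq_trans (msize_sum _ _ _) _; apply/bigmax_leqP => i _.
apply: leq_trans (msizeZ_le _ _) _; rewrite msizeX.
by rewrite -low_codom codom_f.
Qed.

Lemma combination_top_size u : (msize (combination top u) <= s.+1)%N.
Proof.
apply: leq_trans (msize_sum _ _ _) _; apply/bigmax_leqP => i _.
apply: leq_trans (msizeZ_le _ _) _; rewrite msizeX ltnS leq_eqVlt.
by rewrite -top_codom codom_f.
Qed.

Lemma split_degree f : (msize f <= s.+1)%N ->
  f = combination low (coefs low f) + combination top (coefs top f).
Proof.
move=> fs; apply/eqP; rewrite -subr_eq0 opprD addrA; apply/eqP/mpolyP => m.
rewrite mcoeff0; case: (leqP (mdeg m) s) => [/tail_coef -> //|ms].
apply/eqP; rewrite mcoeff_eq0; apply: msize_mdeg_ge; apply: leq_trans ms.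
apply: leq_trans (msizeD_le _ _) _; rewrite msizeN geq_max combination_top_size andbT.
apply: leq_trans (msizeD_le _ _) _; rewrite msizeN geq_max fs /=.
exact: leq_trans (combination_low_size _) _.
Qed.

End Graded.

(** * Contracting the points to the origin *)

Lemma split_lshift m n (i : 'I_m) : split (lshift n i) = inl i.
Proof. exact: (unsplitK (inl i)). Qed.

Lemma split_rshift m n (i : 'I_n) : split (rshift m i) = inr i.
Proof. exact: (unsplitK (inr i)). Qed.

Section Scaling.
Variables (k : fieldType) (n s L N a : nat).
Hypothesis char0 : [pchar k] =i pred0.
Variables (low : 'I_L -> 'X_{1..n}) (top : 'I_N -> 'X_{1..n}).
Hypothesis low_inj : injective low.
Hypothesis top_inj : injective top.
Hypothesis low_codom : forall m, (m \in codom low) = (mdeg m < s)%N.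
Hypothesis top_codom : forall m, (m \in codom top) = (mdeg m == s).
Local Notation T := {mpoly k[n]}.
Hypothesis d_gt0 : (0 < L + a)%N.
Variable W : 'M[k]_(a, N).

(** The very compressed ideals whose forms of degree [s] are complementary to the
    span of the rows of [W] all lie in this chart. *)
Definition chart_basis (i : 'I_(L + a)) : T :=
  match split i with
  | inl l => 'X_[low l]
  | inr q => combination top (row q W)
  end.

(** The values of the chart basis at the points: an invertible matrix exactly when the
    ideal of the points lies in the chart. *)
Definition chart_matrix (R : comNzRingType) (h : {rmorphism k -> R}) (P : 'I_(L + a) -> 'I_n -> R) : 'M[R]_(L + a) :=
  col_mx (monomials_at low P) (map_mx h W *m monomials_at top P).

Lemma chart_combination (c : 'rV_(L + a)) :
  \sum_i c 0 i *: chart_basis i =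
  combination low (lsubmx c) + combination top (rsubmx c *m W).
Proof.
rewrite big_split_ord /= combination_mul; congr (_ + _); apply: eq_bigr => i _.
  by rewrite /chart_basis split_lshift mxE.
by rewrite /chart_basis split_rshift mxE.
Qed.

Lemma meval_chart (P : 'I_(L + a) -> 'I_n -> k) (c : 'rV_(L + a)) j :
  (\sum_i c 0 i *: chart_basis i).@[P j] = (c *m chart_matrix idfun P) 0 j.
Proof.
rewrite chart_combination mevalD !meval_combination -{3}(hsubmxK c) mul_row_col mulmxA.
by rewrite map_mx_id // [RHS]mxE.
Qed.

Lemma vanishing_chart (P : 'I_(L + a) -> 'I_n -> k) (f : T) (c : 'rV_(L + a)) :
  (f - \sum_i c 0 i *: chart_basis i \in vanishing P d_gt0) <->
  c *m chart_matrix idfun P = \row_j f.@[P j].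
Proof.
split=> [/vanishingP f0|e]; last first.
  by apply/vanishingP => j; rewrite mevalB meval_chart e mxE subrr.
apply/rowP => j; rewrite [RHS]mxE -meval_chart; apply/eqP; rewrite eq_sym -subr_eq0.
by rewrite -mevalB f0.
Qed.

Lemma basis_vanishing (P : 'I_(L + a) -> 'I_n -> k) : chart_matrix idfun P \in unitmx ->
  basis_mod (vanishing P d_gt0) chart_basis.
Proof.
move=> uM f; exists (\row_j f.@[P j] *m invmx (chart_matrix idfun P)); split.
  by rewrite vanishing_chart mulmxKV.
by move=> c; rewrite vanishing_chart => <-; rewrite mulmxK.
Qed.

Lemma unit_injective (P : 'I_(L + a) -> 'I_n -> k) : chart_matrix idfun P \in unitmx ->
  injective (fun j => \row_i P j i : 'rV[k]_n).
Proof.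
move=> uM j j' /rowP Pjj'.
have Me : chart_matrix idfun P *m delta_mx j (0 : 'I_1) = chart_matrix idfun P *m delta_mx j' 0.
  rewrite -!colE; apply/colP => i; rewrite !mxE.
  have mono M (e : 'I_M -> 'X_{1..n}) l : monomials_at e P l j = monomials_at e P l j'.
    rewrite !mxE; apply: eq_bigr => x _; congr (_ ^+ _).
    by have := Pjj' x; rewrite !mxE.
  case: split => l; first exact: mono.
  by rewrite !mxE; apply: eq_bigr => q _; rewrite mono.
have /colP/(_ j) := can_inj (mulKmx uM) Me; rewrite !mxE !eqxx /= eq_sym.
by case: eqP => // _ /eqP; rewrite oner_eq0.
Qed.

Lemma smooth_point (P : 'I_(L + a) -> 'I_n -> k) : chart_matrix idfun P \in unitmx ->
  exists2 J : hilb k n (L + a), smooth_locus J & hilb_ideal J = vanishing P d_gt0.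
Proof.
move=> uM.
exists (Hilb (ex_intro _ chart_basis (basis_vanishing uM))) => //.
exists (fun j => \row_i P j i); split; first exact: unit_injective.
move=> f; split=> [/vanishingP f0 j|f0].
  by rewrite (meval_eq _ (v2 := P j)) // => i; rewrite mxE.
by apply/vanishingP => j; rewrite -[RHS](f0 j); apply: meval_eq => i; rewrite mxE.
Qed.

Variable r : chart_fun k n (L + a).

(** The arguments of [r] in coordinates with respect to [chart_basis], modulo an ideal
    that contains m^(s+1) and in which [Y] gives the coordinates of the monomials of
    degree [s]: lower monomials belong to the basis and higher ones are zero. *)
Definition cone_coordinates (R : comNzRingType) (h : {rmorphism k -> R}) (Y : 'M[R]_(N, a)) : 'M[R]_(cf_size r, L + a) :=
  row_mx (\matrix_(x < cf_size r, l < L) h (cf_arg x)@_(low l))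
         ((\matrix_(x < cf_size r, q < N) h (cf_arg x)@_(top q)) *m Y).

Definition top_coordinates (P : 'I_(L + a) -> 'I_n -> k) : 'M_(N, a) :=
  rsubmx (monomials_at top P *m invmx (chart_matrix idfun P)).

Hypothesis smooth_zero : forall J : hilb k n (L + a),
  smooth_locus J -> basis_mod J chart_basis -> chart_zero chart_basis r J.

Section Family.
Variable P : 'I_(L + a) -> 'I_n -> k.
Hypothesis uM : chart_matrix idfun P \in unitmx.

(* The degree of the [i]-th element of the chart basis, which is homogeneous. *)
Let weight (i : 'I_(L + a)) : nat := match split i with inl l => mdeg (low l) | inr _ => s end.

Let value (m : 'X_{1..n}) : 'rV[k]_(L + a) := \row_j mmap1 (P j) m.

(* The coordinates of ['X_[m]] modulo the ideal of the contracted points [t P], as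
   polynomials in [t]. *)
Let coord (m : 'X_{1..n}) (i : 'I_(L + a)) : {poly k} :=
  if (mdeg m < s)%N then
    match split i with inl l => (low l == m)%:R | inr _ => 0 end
  else ((value m *m invmx (chart_matrix idfun P)) 0 i)%:P * 'X^(mdeg m - weight i).

Let scaled (t : k) (j : 'I_(L + a)) (i : 'I_n) : k := t * P j i.

Let mmap1_scaled t j m : mmap1 (scaled t j) m = t ^+ mdeg m * mmap1 (P j) m.
Proof.
rewrite /mmap1 /scaled; under eq_bigr => i _ do rewrite exprMn.
by rewrite big_split /= mdegE expr_sum.
Qed.

Let chart_scaled t i j :
  chart_matrix idfun (scaled t) i j = t ^+ weight i * chart_matrix idfun P i j.
Proof.
rewrite /weight !mxE; case: split => l; first by rewrite !mxE mmap1_scaled.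
rewrite !mxE mulr_sumr; apply: eq_bigr => q _; rewrite !mxE mmap1_scaled.
have -> : mdeg (top q) = s by apply/eqP; rewrite -top_codom codom_f.
by rewrite mulrCA.
Qed.

Let weight_le i : (weight i <= s)%N.
Proof.
rewrite /weight; case: split => l //; apply: ltnW.
by rewrite -low_codom codom_f.
Qed.

Let coordE t m j :
  \sum_i (coord m i).[t] * chart_matrix idfun (scaled t) i j = mmap1 (scaled t j) m.
Proof.
rewrite /coord; case: ltnP => ms.
  have : m \in codom low by rewrite low_codom.
  case/codomP => l ->; rewrite big_split_ord /= [X in _ + X]big1 => [|i _]; last first.
    by rewrite split_rshift horner0 mul0r.
  rewrite addr0 (bigD1 l) //= split_lshift eqxx hornerC mul1r big1 => [|i il].
    by rewrite addr0 col_mxEu mxE.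
  by rewrite split_lshift (inj_eq low_inj) (negPf il) horner0 mul0r.
transitivity (\sum_i t ^+ mdeg m * ((value m *m invmx (chart_matrix idfun P)) 0 i * chart_matrix idfun P i j)).
  apply: eq_bigr => i _; rewrite hornerM hornerXn hornerC chart_scaled.
  by rewrite -[in RHS](subnK (leq_trans (weight_le i) ms)) exprD; ring.
rewrite mmap1_scaled -mulr_sumr; congr (_ * _).
by have := mulmxKV uM (value m); move/rowP/(_ j); rewrite [LHS]mxE [X in _ = X]mxE.
Qed.

Let curve : 'M[{poly k}]_(cf_size r, L + a) :=
  \matrix_(x < cf_size r, i < L + a) \sum_(m <- msupp (cf_arg x)) ((cf_arg x)@_m)%:P * coord m i.

Let curveE t x j :
  (cf_arg x).@[scaled t j] =
  (row x (map_mx (horner_eval t) curve) *m chart_matrix idfun (scaled t)) 0 j.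
Proof.
rewrite mevalE mxE; under [RHS]eq_bigr => i _.
  rewrite [row _ _ _ _]mxE [map_mx _ _ _ _]mxE [curve _ _]mxE /horner_eval horner_sum mulr_suml.
  under eq_bigr => m _ do rewrite hornerM hornerC -mulrA.
  over.
rewrite exchange_big; apply: eq_bigr => m _ /=.
by rewrite -mulr_sumr coordE.
Qed.

(** Contract the points to the origin by [P |-> t P].  Modulo the ideal of [t P] the
    coordinates of each monomial are polynomials in [t], because a monomial of degree
    at least [s] is at least as heavy as every element of the basis.  The function
    [r] vanishes for all [t != 0], hence for [t = 0], where only the coordinates of
    the monomials of degree [s] are left. *)
Lemma cone_zero :
  (cf_poly r).@[fun i => mxvec (cone_coordinates idfun (top_coordinates P)) 0 i] = 0.
Proof.
(* The function [r] along the contraction. *)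
pose h := mmap polyC (fun i => mxvec curve 0 i) (cf_poly r).
have hE t : h.[t] = (cf_poly r).@[fun i => mxvec (map_mx (horner_eval t) curve) 0 i].
  by rewrite horner_mmap; apply: meval_eq => i; rewrite -map_mxvec [RHS]mxE.
have h0 : h = 0.
  apply: (poly_eq0_off char0 (negbT (polyX_eq0 _))) => t; rewrite hornerX hE => t0.
  have uMt : chart_matrix idfun (scaled t) \in unitmx.
    have -> : chart_matrix idfun (scaled t) = diag_mx (\row_i t ^+ weight i) *m chart_matrix idfun P.
      by apply/matrixP => i j; rewrite mul_diag_mx [RHS]mxE chart_scaled [X in _ = X * _]mxE.
    rewrite unitmx_mul uM andbT unitmxE det_diag unitfE.
    by apply/prodf_neq0 => i _; rewrite mxE expf_neq0.
  have [J sJ JE] := smooth_point uMt.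
  apply: (smooth_zero sJ) => [|x]; rewrite JE; first exact: basis_vanishing.
  have := vanishing_chart (scaled t) (cf_arg x) (row x (map_mx (horner_eval t) curve)).
  under eq_bigr => i _ do rewrite mxE.
  move=> ->; apply/rowP => j; rewrite [RHS]mxE; exact/esym/curveE.
suff <- : map_mx (horner_eval 0) curve = cone_coordinates idfun (top_coordinates P).
  by rewrite -hE h0 horner0.
apply/matrixP => x i; rewrite [map_mx _ _ _ _]mxE [curve _ _]mxE /horner_eval horner_sum.
have coefE m : (cf_arg x)@_m = \sum_(m' <- msupp (cf_arg x)) (cf_arg x)@_m' * (m == m')%:R.
  rewrite {1}(mpolyE (cf_arg x)) raddf_sum; apply: eq_bigr => m' _.
  by rewrite /= mcoeffZ mcoeffX eq_sym.
under eq_bigr => m _ do rewrite hornerM hornerC.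
case: (split_ordP i) => l ->; rewrite ?row_mxEl ?row_mxEr.
  rewrite mxE [RHS]coefE; apply: eq_bigr => m _; congr (_ * _).
  rewrite /coord split_lshift; case: ltnP => ms; first by case: eqP; rewrite hornerE.
  have lm : (mdeg (low l) < mdeg m)%N by apply: leq_trans ms; rewrite -low_codom codom_f.
  rewrite hornerM hornerXn /weight split_lshift expr0n subn_eq0 leqNgt lm mulr0.
  by case: eqP lm => // ->; rewrite ltnn.
rewrite mxE; under [RHS]eq_bigr => q _ do rewrite mxE coefE mulr_suml.
rewrite exchange_big; apply: eq_bigr => m _ /=.
under [RHS]eq_bigr => q _ do rewrite -mulrA.
rewrite -mulr_sumr; congr (_ * _); rewrite /coord split_rshift; case: ltngtP => ms.
- rewrite horner0 big1 // => q _; case: eqP => [e|_]; last by rewrite mul0r.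
  by move: ms; rewrite -e ltn_neqAle -top_codom codom_f.
- rewrite hornerM hornerXn /weight split_rshift expr0n subn_eq0 leqNgt ms mulr0.
  rewrite big1 // => q _; case: eqP => [e|_]; last by rewrite mul0r.
  by move: ms; rewrite -e ltn_neqAle eq_sym -top_codom codom_f.
- have : m \in codom top by rewrite top_codom ms.
  case/codomP => q ->; rewrite (bigD1 q) //= eqxx mul1r big1 => [|q' qq']; last first.
    by rewrite (inj_eq top_inj) (negPf qq') mul0r.
  rewrite addr0 hornerM hornerXn hornerC /weight split_rshift.
  have -> : mdeg (top q) = s by apply/eqP; rewrite -top_codom codom_f.
  rewrite subnn mulr1 /top_coordinates !mxE; apply: eq_bigr => j _.
  by rewrite !mxE.
Qed.

End Family.

End Scaling.

(** * Lifting curves of leading forms to curves of points *)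

Lemma sum_pair (V : nmodType) (I J : finType) (F : I * J -> V) :
  \sum_u F u = \sum_i \sum_j F (i, j).
Proof. by rewrite pair_bigA; apply: eq_bigr => -[]. Qed.

Lemma meval_deriv_combination (k : fieldType) n M (e : 'I_M -> 'X_{1..n}) (u : 'rV[k]_M) x v :
  (combination e u)^`M(x).@[v] = \sum_i u 0 i * ('X_[e i])^`M(x).@[v].
Proof.
rewrite /combination (linear_sum (mderiv x)) raddf_sum /=; apply: eq_bigr => i _.
by rewrite linearZ mevalZ.
Qed.

Section Lifting.
Variables (k : fieldType) (n L N b d : nat).
Variables (low : 'I_L -> 'X_{1..n}) (top : 'I_N -> 'X_{1..n}).
Variables (P0 : 'I_d -> 'I_n -> k) (K0 D : 'M[k]_(b, N)) (Z0 : 'M[k]_(b, L)).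

Let f (i : 'I_b) : {mpoly k[n]} := combination top (row i K0) - combination low (row i Z0).

Hypothesis f_vanishes : forall i j, (f i).@[P0 j] = 0.
Hypothesis unobstructed : forall c : 'I_b -> 'I_d -> k,
  (forall i l, \sum_j c i j * mmap1 (P0 j) (low l) = 0) ->
  (forall j x, \sum_i c i j * ((f i)^`M(x)).@[P0 j] = 0) ->
  forall i j, c i j = 0.

(** The value at the [j]-th moving point of a polynomial with leading form [K0 + t D]
    and lower terms [- Z]: all residues vanish when the forms [K0 + t D] are leading
    forms of polynomials through the moving points. *)
Definition residue (P : 'I_d -> 'I_n -> {poly k}) (Z : 'I_b -> 'I_L -> {poly k}) i j : {poly k} :=
  \sum_q ((K0 i q)%:P + 'X * (D i q)%:P) * mmap1 (P j) (top q) -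
  \sum_l Z i l * mmap1 (P j) (low l).

Let horner_mmap1 (u : 'I_n -> {poly k}) m t : (mmap1 u m).[t] = mmap1 (fun i => (u i).[t]) m.
Proof. by rewrite -(mmapX u polyC m) horner_mmap /meval mmapX. Qed.

Let mmap1_eq0 (P : 'I_d -> 'I_n -> {poly k}) j m : (forall j x, (P j x).[0] = P0 j x) ->
  (mmap1 (P j) m).[0] = mmap1 (P0 j) m.
Proof. by move=> P00; rewrite horner_mmap1; apply: mmap1_eq => x. Qed.

Let residue0 P Z i j : (forall j x, (P j x).[0] = P0 j x) ->
  (forall i l, (Z i l).[0] = Z0 i l) -> (residue P Z i j).[0] = (f i).@[P0 j].
Proof.
move=> P00 Z00; rewrite /residue hornerD hornerN !horner_sum /f mevalB; congr (_ - _).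
  rewrite raddf_sum; apply: eq_bigr => q _.
  by rewrite /= mevalZ mxE !hornerE mmap1_eq0 // /meval mmapX.
rewrite raddf_sum; apply: eq_bigr => q _.
by rewrite /= mevalZ mxE !hornerE mmap1_eq0 // Z00 /meval mmapX.
Qed.

(** The linearised equations can be solved: the unknowns are the velocities of the
    points and of the lower terms, and [unobstructed] is the injectivity of the
    transposed system. *)
Let tangent_solution (rho : 'I_b -> 'I_d -> k) :
  exists (p : 'I_d -> 'I_n -> k) (z : 'I_b -> 'I_L -> k), forall i j,
    \sum_x p j x * ((f i)^`M(x)).@[P0 j] - \sum_l z i l * mmap1 (P0 j) (low l) = rho i j.
Proof.
pose A (u : 'I_b * 'I_d) (v : ('I_d * 'I_n) + ('I_b * 'I_L)) : k :=
  match v with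
  | inl (j, x) => (u.2 == j)%:R * ((f u.1)^`M(x)).@[P0 j]
  | inr (i, l) => - (u.1 == i)%:R * mmap1 (P0 u.2) (low l)
  end.
have inj (c : 'I_b * 'I_d -> k) : (forall v, \sum_u c u * A u v = 0) -> forall u, c u = 0.
  move=> cA [i j]; apply: (unobstructed (c := fun i j => c (i, j))) => [{}i l|{}j x].
    have := cA (inr (i, l)); rewrite sum_pair /=.
    rewrite (bigD1 i) //= [X in _ + X]big1 => [|i' ii']; last first.
      by rewrite big1 // => j' _; rewrite (negPf ii') oppr0 mul0r mulr0.
    move/eqP; rewrite addr0 -oppr_eq0 -sumrN => /eqP cA0; rewrite -[RHS]cA0.
    by apply: eq_bigr => j' _; rewrite eqxx mulN1r mulrN opprK.
  have := cA (inl (j, x)); rewrite sum_pair /=.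
  move=> cA0; rewrite -[RHS]cA0; apply: eq_bigr => i' _.
  rewrite (bigD1 j) //= [X in _ + X]big1 => [|j' jj']; last by rewrite (negPf jj') mul0r mulr0.
  by rewrite eqxx mul1r addr0.
have [v Av] := linear_surj inj (fun u => rho u.1 u.2).
exists (fun j x => v (inl (j, x))), (fun i l => v (inr (i, l))) => i j.
rewrite -[RHS](Av (i, j)) big_sumType /=; congr (_ + _).
  rewrite sum_pair /= (bigD1 j) //=.
  rewrite [X in _ + X]big1 => [|j' jj']; last first.
    by rewrite big1 // => x _; rewrite eq_sym (negPf jj') !mul0r.
  by rewrite addr0; apply: eq_bigr => x _; rewrite eqxx mul1r mulrC.
rewrite sum_pair /= (bigD1 i) //=.
rewrite [X in _ + X]big1 => [|i' ii']; last first.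
  by rewrite big1 // => x _; rewrite eq_sym (negPf ii') oppr0 !mul0r.
by rewrite addr0 -sumrN; apply: eq_bigr => x _; rewrite eqxx mulN1r mulNr mulrC.
Qed.

(** Newton's method.  If the residues are divisible by [t^(m+1)], a correction of
    order [t^(m+1)] found by [tangent_solution] removes their next coefficient, and
    its second-order effects have order [t^(2m+2)]. *)
Lemma curve_lift m : exists P Z,
  [/\ forall j x, (P j x).[0] = P0 j x, forall i l, (Z i l).[0] = Z0 i l &
      forall i j, ('X^(m.+1) %| residue P Z i j)%R].
Proof.
elim: m => [|m [P [Z [P00 Z00 res]]]].
  (* At first the points stay where they are, which is correct modulo [t]. *)
  exists (fun j x => (P0 j x)%:P), (fun i l => (Z0 i l)%:P).
  split=> [j x|i l|i j]; rewrite ?hornerC //.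
  rewrite expr1 -['X]subr0 -polyC0 dvdp_XsubCl /root residue0 ?f_vanishes // => *;
    by rewrite hornerC.
pose e : {poly k} := 'X^(m.+1).
pose R i j := (residue P Z i j %/ 'X^(m.+1)).
have RE i j : residue P Z i j = e * R i j by rewrite mulrC divpK.
have [p [z pz]] := tangent_solution (fun i j => - (R i j).[0]).
pose P' j x := P j x + e * (p j x)%:P.
pose Z' i l := Z i l + e * (z i l)%:P.
pose dd j m' := \sum_x (p j x)%:P * mmap polyC (P j) ('X_[m'])^`M(x).
pose rr j m' := (mmap1 (P' j) m' - mmap1 (P j) m' - e * dd j m') %/ e ^+ 2.
have e_neq0 : e != 0 by rewrite monic_neq0 ?monicXn.
have taylor j m' : mmap1 (P' j) m' = mmap1 (P j) m' + e * dd j m' + e ^+ 2 * rr j m'.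
  have [r] := mmap_taylor polyC (P j) (fun x => (p j x)%:P) e 'X_[m'].
  rewrite !mmapX -/(dd j m') -/(P' j) => E; rewrite /rr E.
  have -> : mmap1 (P j) m' + e * dd j m' + e ^+ 2 * r - mmap1 (P j) m' - e * dd j m' = r * e ^+ 2.
    by ring.
  by rewrite (mulpK _ (expf_neq0 2 e_neq0)).
have e0 : e.[0] = 0 by rewrite hornerXn expr0n.
exists P', Z'; split=> [j x|i l|i j]; rewrite ?hornerD ?hornerM ?e0 ?mul0r ?addr0 //.
have tail : 'X^(m.+2) %| e ^+ 2.
  by rewrite /e -exprM dvdp_exp2l // mulnS muln1 addSn addnS ltnS leq_addr.
have lin3 (I : finType) (c x y w : I -> {poly k}) :
    \sum_i c i * (x i + e * y i + e ^+ 2 * w i) =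
    \sum_i c i * x i + e * \sum_i c i * y i + e ^+ 2 * \sum_i c i * w i.
  by rewrite !mulr_sumr -!big_split; apply: eq_bigr => u _ /=; ring.
pose kap q := (K0 i q)%:P + 'X * (D i q)%:P.
(* The coefficient of [e] in the new residue, of which the constant term is killed
   by the choice of [p] and [z], and the coefficient of [e ^+ 2]. *)
pose br := R i j + \sum_q kap q * dd j (top q)
  - \sum_l Z i l * dd j (low l) - \sum_l (z i l)%:P * mmap1 (P j) (low l).
pose hi := \sum_q kap q * rr j (top q) - \sum_l Z i l * rr j (low l)
  - \sum_l (z i l)%:P * dd j (low l) - e * \sum_l (z i l)%:P * rr j (low l).
have -> : residue P' Z' i j = e * br + e ^+ 2 * hi.
  rewrite /residue -/kap; under eq_bigr => q _ do rewrite taylor.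
  under [X in _ - X]eq_bigr => l _ do rewrite taylor /Z' mulrDl -mulrA.
  rewrite big_split -mulr_sumr !lin3 /br /hi /=.
  have -> : \sum_q kap q * mmap1 (P j) (top q) = e * R i j + \sum_l Z i l * mmap1 (P j) (low l).
    by rewrite -RE /residue subrK.
  by ring.
apply: dvdp_add; last exact: dvdp_mulr.
rewrite exprSr dvdp_mul //.
rewrite -['X]subr0 -polyC0 dvdp_XsubCl /root /br !hornerD !hornerN !horner_sum.
have ddE m' : (dd j m').[0] = \sum_x p j x * ('X_[m']^`M(x)).@[P0 j].
  rewrite horner_sum; apply: eq_bigr => x _; rewrite hornerM hornerC horner_mmap.
  by congr (_ * _); apply: meval_eq => y.
rewrite -[(R i j).[0]]opprK -pz.
have -> : \sum_x p j x * (f i)^`M(x).@[P0 j] =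
    \sum_q (kap q * dd j (top q)).[0] - \sum_l (Z i l * dd j (low l)).[0].
  under [X in _ = X - _]eq_bigr => q _.
    rewrite hornerM ddE mulr_sumr !hornerE; over.
  under [X in _ = _ - X]eq_bigr => l _.
    rewrite hornerM ddE mulr_sumr Z00; over.
  rewrite exchange_big [X in _ = _ - X]exchange_big -sumrB; apply: eq_bigr => x _.
  rewrite /f mderivB mevalB mulrBr !meval_deriv_combination !mulr_sumr.
  by congr (_ + _); rewrite ?sumrN; congr (- _) || idtac; apply: eq_bigr => q _; rewrite mxE mulrCA.
under [X in _ - X == _]eq_bigr => l _ do rewrite hornerM hornerC mmap1_eq0 //.
by apply/eqP; ring.
Qed.

End Lifting.

(** * Powers of the maximal ideal *)

Section MaximalIdealPowers.
Variables (k : fieldType) (n : nat).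
Local Notation T := {mpoly k[n]}.

(** The power m^r of the maximal ideal, described by coefficients. *)
Definition order_ge (r : nat) (f : T) := forall m, (mdeg m < r)%N -> f@_m = 0.

Lemma order_ge_mul r r' f g : order_ge r f -> order_ge r' g -> order_ge (r + r') (f * g).
Proof.
move=> fr gr m mr; rewrite mcoeffM big1 // => -[[m1 b1] [m2 b2]] /= /eqP mE.
case: (ltnP (mdeg m1) r) => [/fr -> |r1]; first by rewrite mul0r.
rewrite gr ?mulr0 //; move: mr; rewrite mE mdegD => mr.
by rewrite -(ltn_add2l r); apply: leq_ltn_trans mr; rewrite leq_add2r.
Qed.

Lemma order_ge_sum r (I : finType) (F : I -> T) : (forall i, order_ge r (F i)) -> order_ge r (\sum_i F i).
Proof. by move=> Fr m mr; rewrite raddf_sum big1 // => i _; rewrite /= Fr. Qed.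

Lemma ideal_pow_order s f : ideal_pow (@max_ideal k n) s f -> order_ge s f.
Proof.
have max1 g : max_ideal g -> order_ge 1 g.
  case=> m [c [e [eX ->]]]; apply: order_ge_sum => i; rewrite -[1%N]add0n.
  apply: order_ge_mul => [//|m']; case: (eX i) => x ->.
  rewrite ltnS leqn0 mdeg_eq0 => /eqP ->; rewrite mcoeffX.
  by case: eqP => // /(congr1 (@mdeg n)); rewrite mdeg0 mdeg1.
case=> m [c [g [gP ->]]]; apply: order_ge_sum => i; rewrite -[s]add0n.
apply: order_ge_mul => // ; case: (gP i) => h [hm ->].
elim: s h {gP} hm => [|s IH] h hm; first by rewrite big_ord0.
by rewrite big_ord_recl; apply: (@order_ge_mul 1 s); [apply: max1|apply: IH].
Qed.

Lemma monomial_factor r m : (r <= mdeg m)%N -> exists m' (x : 'I_r -> 'I_n),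
  'X_[m] = 'X_[m'] * \prod_i 'X_(x i) :> T.
Proof.
elim: r m => [|r IH] m mr.
  have x : 'I_0 -> 'I_n by case.
  by exists m, x; rewrite big_ord0 mulr1.
have [x mx] : exists x, (0 < m x)%N.
  case: (pickP (fun x => (0 < m x)%N)) => [x mx|m0]; first by exists x.
  move: mr; rewrite mdegE big1 // => x _; apply/eqP.
  by have /negbT := m0 x; rewrite -eqn0Ngt.
have mE : m = (U_(x) + (m - U_(x)))%MM.
  apply/mnmP => y; rewrite mnmDE mnmBE mnm1E; case: eqP => [<-|_]; first by rewrite subnKC.
  by rewrite add0n subn0.
have [|m' [h hE]] := IH (m - U_(x))%MM.
  by move: mr; rewrite {1}mE mdegD mdeg1.
exists m', (fun i => oapp h x (unlift ord0 i)); rewrite big_ord_recl unlift_none /=.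
under eq_bigr => i _ do rewrite liftK /=.
by rewrite {1}mE mpolyXD hE mulrCA.
Qed.

Lemma ideal_pow_monomial r m : (r <= mdeg m)%N -> ideal_pow (@max_ideal k n) r 'X_[m].
Proof.
move=> mr; have [m' [x mE]] := monomial_factor mr.
exists 1%N, (fun=> 'X_[m']), (fun=> \prod_i 'X_(x i)); rewrite big_ord1; split=> // _.
exists (fun i => 'X_(x i)); split=> // i.
exists 1%N, (fun=> 1), (fun=> 'X_(x i)); rewrite big_ord1 mul1r; split=> // _.
by exists (x i).
Qed.

End MaximalIdealPowers.

Lemma enumerate_monomials n (Q : pred 'X_{1..n}) s : (forall m, Q m -> (mdeg m <= s)%N) ->
  exists M (e : 'I_M -> 'X_{1..n}), injective e /\ forall m, (m \in codom e) = Q m.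
Proof.
move=> Qs; pose A := [pred m : 'X_{1..n < s.+1} | Q m].
exists #|A|, (fun i => val (enum_val i : 'X_{1..n < s.+1})); split.
  by move=> i j /val_inj /enum_val_inj.
move=> m; apply/codomP/idP => [[i ->]|Qm]; first exact: (enum_valP i).
pose m' := BMultinom (Qs m Qm : (mdeg m < s.+1)%N).
have mA : m' \in A by [].
by exists (enum_rank_in mA m'); rewrite enum_rankK_in.
Qed.

Lemma idealZ (k : fieldType) n (I : idealr {mpoly k[n]}) c f : f \in I -> c *: f \in I.
Proof. by move=> fI; rewrite -mul_mpolyC idealMr. Qed.

Lemma ideal_combine (k : fieldType) n (I : idealr {mpoly k[n]}) (M d : nat)
    (F : 'I_M -> {mpoly k[n]}) (B : 'I_d -> {mpoly k[n]}) (A : 'M_(M, d)) (e : 'rV_M) :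
  (forall i, F i - \sum_j A i j *: B j \in I) ->
  \sum_i e 0 i *: F i - \sum_j (e *m A) 0 j *: B j \in I.
Proof.
move=> FI; have -> : \sum_i e 0 i *: F i - \sum_j (e *m A) 0 j *: B j =
    \sum_i e 0 i *: (F i - \sum_j A i j *: B j).
  under [RHS]eq_bigr => i _ do rewrite scalerBr scaler_sumr.
  rewrite sumrB; congr (_ - _); rewrite exchange_big; apply: eq_bigr => j _.
  by rewrite mxE scaler_suml; apply: eq_bigr => i _; rewrite scalerA.
by apply: rpred_sum => i _; apply: idealZ.
Qed.

(** In finite dimension [d], a family of [d] elements that spans is a basis. *)
Lemma spanning_basis (k : fieldType) n d (I : idealr {mpoly k[n]}) (B B' : 'I_d -> {mpoly k[n]}) :
  basis_mod I B' -> (forall f, exists c : 'rV_d, f - \sum_j c 0 j *: B j \in I) ->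
  basis_mod I B.
Proof.
move=> bB' span.
have [G GP] := fin_all_exists (fun j => span (B' j)).
have ex i : exists c : 'rV_d, B i - \sum_j c 0 j *: B' j \in I.
  by have [c [cP _]] := bB' (B i); exists c.
have [H HP] := fin_all_exists ex.
pose Gm := \matrix_(i, j) G i 0 j; pose Hm := \matrix_(i, j) H i 0 j.
have toB (e : 'rV_d) : \sum_i e 0 i *: B i - \sum_j (e *m Hm) 0 j *: B' j \in I.
  by apply: (@ideal_combine k n I d d B B' Hm e) => i; under eq_bigr do rewrite mxE.
have toB' (e : 'rV_d) : \sum_i e 0 i *: B' i - \sum_j (e *m Gm) 0 j *: B j \in I.
  by apply: (@ideal_combine k n I d d B' B Gm e) => i; under eq_bigr do rewrite mxE.
have uniq0 (e : 'rV_d) : \sum_i e 0 i *: B' i \in I -> e = 0.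
  move=> eI; have [c [_ c_uniq]] := bB' (\sum_i e 0 i *: B' i).
  have <- : c = e by apply: c_uniq; rewrite subrr rpred0.
  by apply: c_uniq; rewrite [X in _ - X]big1 ?subr0 // => i _; rewrite mxE scale0r.
have linB (F : 'I_d -> {mpoly k[n]}) (u v : 'rV_d) :
    \sum_i (u - v) 0 i *: F i = \sum_i u 0 i *: F i - \sum_i v 0 i *: F i.
  by rewrite -sumrB; apply: eq_bigr => i _; rewrite !mxE scalerBl.
have GH : Gm *m Hm = 1%:M.
  apply/row_matrixP => i; rewrite !rowE; apply/eqP; rewrite eq_sym -subr_eq0.
  apply/eqP/uniq0; rewrite linB mulmx1 mulmxA.
  have := rpredD (toB' (delta_mx 0 i)) (toB (delta_mx 0 i *m Gm)).
  by rewrite addrA subrK.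
move=> f; have [c cP] := span f; exists c; split=> // c' cP'.
apply/eqP; rewrite -subr_eq0; apply/eqP.
rewrite -[_ - _]mulmx1 -(mulmx1C GH) mulmxA.
suff -> : (c - c') *m Hm = 0 by rewrite mul0mx.
apply: uniq0; have := rpredB (rpredB cP' cP) (toB (c - c')).
rewrite linB => h; rewrite (_ : \sum_i _ = f - \sum_j c' 0 j *: B j - (f - \sum_j c 0 j *: B j) -
  (\sum_i c 0 i *: B i - \sum_i c' 0 i *: B i - \sum_i ((c - c') *m Hm) 0 i *: B' i)) //.
by ring.
Qed.

(** Monomials of degree less than [s] are independent modulo an ideal contained in
    m^s, and those of degree at most [s] span modulo an ideal that contains m^(s+1). *)
Lemma colength_bounds (k : fieldType) n s d L N (low : 'I_L -> 'X_{1..n}) (top : 'I_N -> 'X_{1..n})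
    (I : idealr {mpoly k[n]}) :
  injective low -> injective top ->
  (forall m, (m \in codom low) = (mdeg m < s)%N) -> (forall m, (m \in codom top) = (mdeg m == s)) ->
  colength I d ->
  (forall f, ideal_pow (@max_ideal k n) s.+1 f -> f \in I) ->
  (forall f, f \in I -> ideal_pow (@max_ideal k n) s f) -> (L <= d <= L + N)%N.
Proof.
move=> low_inj top_inj low_codom top_codom [B BP] I_lower I_upper.
have coords M (e : 'I_M -> {mpoly k[n]}) : exists A : 'M_(M, d), forall i, e i - \sum_j A i j *: B j \in I.
  have ex i : exists c : 'rV_d, e i - \sum_j c 0 j *: B j \in I.
    by have [c [cP _]] := BP (e i); exists c.
  have [R RP] := fin_all_exists ex; exists (\matrix_(i, j) R i 0 j) => i.
  by under eq_bigr do rewrite mxE.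
apply/andP; split.
  have [A AP] := coords _ (fun l => 'X_[low l]).
  suff /eqP <- : row_free A by apply: rank_leq_col.
  apply: inj_row_free => u uA; apply/rowP => l; rewrite -(combinationE u low_inj) mxE.
  apply: (@ideal_pow_order k n s); last by rewrite -low_codom codom_f.
  apply: I_upper; have := ideal_combine u AP; rewrite uA [X in _ - X]big1 ?subr0 // => j _.
  by rewrite mxE scale0r.
pose e (i : 'I_(L + N)) : {mpoly k[n]} := match split i with inl l => 'X_[low l] | inr q => 'X_[top q] end.
have [A AP] := coords _ e.
suff /eqP <- : row_full A by apply: rank_leq_row.
rewrite -sub1mx; apply/row_subP => j; rewrite rowE mulmx1; set c := delta_mx 0 j.
pose f := \sum_i c 0 i *: B i; pose v := row_mx (coefs low f) (coefs top f).
apply/submxP; exists v; have [c' [_ uniq_c]] := BP f.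
have <- : c' = c by apply: uniq_c; rewrite subrr rpred0.
apply: uniq_c; have := ideal_combine v AP; rewrite big_split_ord /=.
under eq_bigr => l _ do rewrite /e split_lshift row_mxEl.
under [X in _ + X - _]eq_bigr => l _ do rewrite /e split_rshift row_mxEr.
move=> vI; rewrite -[f](subrK (combination low (coefs low f) + combination top (coefs top f))) -addrA.
apply: rpredD vI; rewrite opprD addrA; set g := f - _ - _.
rewrite (mpolyE g) rpred_sum // => m _; case: (leqP (mdeg m) s) => ms.
  by rewrite (tail_coef low_inj top_inj low_codom top_codom f ms) scale0r rpred0.
exact/idealZ/I_lower/ideal_pow_monomial.
Qed.

(** * Limits of general points *)

Lemma kernel_basis (k : fieldType) b m p (E : 'M[k]_(m, p)) : (\rank E + b)%N = m ->
  exists F : 'M_(b, m), [/\ row_free F, F *m E = 0 & forall v : 'rV_m, v *m E = 0 -> exists c, v = c *m F].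
Proof.
move=> rE; have bE : b = \rank (kermx E) by rewrite mxrank_ker -[X in (X - _)%N]rE addKn.
subst b; exists (row_base (kermx E)); split; first exact: row_base_free.
  by apply/eqP; rewrite -sub_kermx eq_row_base.
by move=> v vE; apply/submxP; rewrite eq_row_base; apply/sub_kermxP.
Qed.

(** The conditions on the points [P] that make their ideal a smooth and well-behaved
    starting point.  The last one is the dual form of a surjectivity: the family [g]
    is an element of the dual of the tangent space of the Grassmannian at the space
    of leading forms of the polynomials of degree [s] through [P], and it is
    orthogonal to the velocity of this space under every motion of the points. *)
Record general_points (k : fieldType) (n s d : nat) (P : 'I_d -> 'I_n -> k) : Prop := GeneralPoints {
  points_separate : forall h : {mpoly k[n]}, (msize h <= s)%N -> (forall j, h.@[P j] = 0) -> h = 0;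
  points_independent : forall mu : 'I_d -> k,
    (forall h : {mpoly k[n]}, (msize h <= s.+1)%N -> \sum_j mu j * h.@[P j] = 0) -> forall j, mu j = 0;
  points_unobstructed : forall g : 'I_d -> {mpoly k[n]},
    (forall j, (msize (g j) <= s.+1)%N) -> (forall j j', (g j).@[P j'] = 0) ->
    (forall h : {mpoly k[n]}, (msize h <= s)%N -> \sum_j h.@[P j] *: g j = 0) ->
    (forall j x, (g j)^`M(x).@[P j] = 0) -> forall j, g j = 0
}.

Section Smoothing.
Variables (k : fieldType) (n s L a b : nat).
Hypothesis char0 : [pchar k] =i pred0.
Variables (low : 'I_L -> 'X_{1..n}) (top : 'I_(b + a) -> 'X_{1..n}).
Hypothesis low_inj : injective low.
Hypothesis top_inj : injective top.
Hypothesis low_codom : forall m, (m \in codom low) = (mdeg m < s)%N.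
Hypothesis top_codom : forall m, (m \in codom top) = (mdeg m == s).
Local Notation T := {mpoly k[n]}.
Hypothesis d_gt0 : (0 < L + a)%N.
Variable P0 : 'I_(L + a) -> 'I_n -> k.
Hypothesis P0_general : general_points s P0.

Let E0 := col_mx (monomials_at low P0) (monomials_at top P0).

Let combination0 M (e : 'I_M -> 'X_{1..n}) (u : 'rV[k]_M) : injective e -> combination e u = 0 -> u = 0.
Proof. by move=> e_inj u0; apply/rowP => i; rewrite -(combinationE u e_inj) u0 mcoeff0 mxE. Qed.

Let combinationN M (e : 'I_M -> 'X_{1..n}) (u : 'rV[k]_M) : combination e (- u) = - combination e u.
Proof. by rewrite -scaleN1r combinationZ scaleN1r. Qed.

Lemma low_expansion (h : T) : (msize h <= s)%N -> h = combination low (coefs low h).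
Proof.
move=> hs; rewrite {1}(split_degree low_inj top_inj low_codom top_codom (leqW hs)).
rewrite [X in _ + X](_ : _ = 0) ?addr0 //; apply: big1 => q _; rewrite mxE.
have := top_codom (top q); rewrite codom_f => /esym /eqP tq.
have /msize_mdeg_ge : (msize h <= mdeg (top q))%N by rewrite tq.
by rewrite -mcoeff_eq0 => /eqP ->; rewrite scale0r.
Qed.

Let meval_pair (u : 'rV_L) (v : 'rV_(b + a)) j :
  (combination low u + combination top v).@[P0 j] = (row_mx u v *m E0) 0 j.
Proof. by rewrite mevalD !meval_combination mul_row_col [RHS]mxE. Qed.

(** The [b] polynomials of degree at most [s] through the points; their leading forms
    [K0] are independent because no polynomial of smaller degree vanishes at all
    the points. *)
Lemma ideal_of_points : exists (Z0 : 'M[k]_(b, L)) (K0 : 'M[k]_(b, b + a)),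
  [/\ row_free K0,
      forall i j, (combination top (row i K0) - combination low (row i Z0)).@[P0 j] = 0 &
      forall u v, (forall j, (combination low u + combination top v).@[P0 j] = 0) ->
        exists c, u = - (c *m Z0) /\ v = c *m K0].
Proof.
have rE0 : (\rank E0 + b)%N = (L + (b + a))%N.
  have /eqP : row_free E0^T.
    apply: inj_row_free => mu muE; apply/rowP => j; rewrite mxE.
    apply: (points_independent P0_general (mu := fun j => mu 0 j)) => h hs.
    rewrite (split_degree low_inj top_inj low_codom top_codom hs).
    under eq_bigr => j' _ do rewrite meval_pair.
    have : (mu *m E0^T *m (row_mx (coefs low h) (coefs top h))^T) 0 0 = 0 by rewrite muE mul0mx mxE.
    rewrite -mulmxA -trmx_mul mxE => muE0; rewrite -[RHS]muE0; apply: eq_bigr => j' _.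
    by rewrite [in RHS]mxE.
  by rewrite mxrank_tr => ->; rewrite addnA addnAC.
have [F [F_free FE Fgen]] := kernel_basis rE0.
exists (- lsubmx F), (rsubmx F); split.
- apply: inj_row_free => c cK.
  have cZ : c *m lsubmx F = 0.
    apply: (combination0 low_inj); apply: (points_separate P0_general) => [|j].
      exact: combination_low_size.
    have := meval_pair (c *m lsubmx F) (c *m rsubmx F) j.
    rewrite -mul_mx_row hsubmxK -mulmxA FE mulmx0 cK mxE => <-.
    by rewrite /combination [X in _ + X]big1 ?addr0 // => i _; rewrite mxE scale0r.
  apply: (row_free_inj F_free); rewrite mul0mx -(hsubmxK F) mul_mx_row cZ cK.
  by rewrite row_mx0.
- move=> i j; rewrite linearN /= combinationN opprK addrC meval_pair -row_row_mx hsubmxK -row_mul FE.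
  by rewrite !mxE.
move=> u v uv; have [|c cE] := Fgen (row_mx u v).
  by apply/rowP => j; rewrite -meval_pair uv mxE.
exists c; move: cE; rewrite -{1}(hsubmxK F) mul_mx_row => /eq_row_mx[-> ->].
by rewrite mulmxN opprK.
Qed.

Variable I : hilb k n (L + a).
Hypothesis I_lower : forall f, ideal_pow (@max_ideal k n) s.+1 f -> f \in hilb_ideal I.
Hypothesis I_upper : forall f, f \in hilb_ideal I -> ideal_pow (@max_ideal k n) s f.

(** Counting dimensions, [I] contains [b] independent polynomials of degree at most
    [s]; they have no terms of degree less than [s], since [I] lies in m^s. *)
Lemma ideal_forms : exists K1 : 'M[k]_(b, b + a),
  row_free K1 /\ forall c : 'rV_b, combination top (c *m K1) \in hilb_ideal I.
Proof.
have [B' B'P] := hilb_colength I.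
pose e (i : 'I_(L + (b + a))) : T := match split i with inl l => 'X_[low l] | inr q => 'X_[top q] end.
have ex i : exists c : 'rV_(L + a), e i - \sum_j c 0 j *: B' j \in hilb_ideal I.
  by have [c [cP _]] := B'P (e i); exists c.
have [R RP] := fin_all_exists ex.
pose A := \matrix_(i, j) R i 0 j.
have le_b : (b <= \rank (kermx A))%N.
  have {1}<- : (L + (b + a) - (L + a))%N = b by rewrite addnA addnAC addKn.
  by rewrite mxrank_ker leq_sub2l ?rank_leq_col.
pose F : 'M_(b, L + (b + a)) := pid_mx b *m row_base (kermx A).
have F_free : row_free F.
  rewrite /row_free /F mxrankMfree ?row_base_free // rank_pid_mx //.
have FA : F *m A = 0.
  rewrite -mulmxA (_ : row_base (kermx A) *m A = 0) ?mulmx0 //.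
  by apply/eqP; rewrite -sub_kermx eq_row_base.
have inI (c : 'rV_b) : combination low (c *m lsubmx F) + combination top (c *m rsubmx F) \in hilb_ideal I.
  have eA i : e i - \sum_j A i j *: B' j \in hilb_ideal I.
    by under eq_bigr do rewrite mxE.
  have := ideal_combine (c *m F) eA; rewrite -mulmxA FA mulmx0.
  rewrite [X in _ - X]big1 => [|j _]; last by rewrite mxE scale0r.
  rewrite subr0 big_split_ord /=.
  rewrite /combination; under eq_bigr => l _ do rewrite /e split_lshift.
  under [X in _ + X]eq_bigr => l _ do rewrite /e split_rshift.
  rewrite -{1 2}(hsubmxK F) mul_mx_row.
  under eq_bigr => l _ do rewrite row_mxEl.
  by under [X in _ + X]eq_bigr => l _ do rewrite row_mxEr.
have F_low : lsubmx F = 0.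
  apply/row_matrixP => i; rewrite rowE row0; apply: (combination0 low_inj).
  apply/mpolyP => m; rewrite mcoeff0; case: (boolP (m \in codom low)) => [mlow|/combination_out -> //].
  have := ideal_pow_order (I_upper (inI (delta_mx 0 i))).
  move/(_ m); rewrite -low_codom mlow mcoeffD => /(_ isT) <-.
  rewrite [X in _ + X]combination_out ?addr0 // top_codom.
  by rewrite neq_ltn -low_codom mlow.
exists (rsubmx F); split=> [|c]; last first.
  have := inI c; rewrite F_low mulmx0 /combination big1 ?add0r // => i _.
  by rewrite mxE scale0r.
apply: inj_row_free => c cF; apply: (row_free_inj F_free).
by rewrite mul0mx -(hsubmxK F) mul_mx_row F_low cF mulmx0 row_mx0.
Qed.

Section Limit.
Variables (K0 : 'M[k]_(b, b + a)) (Z0 : 'M[k]_(b, L)) (W : 'M[k]_(a, b + a)).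
Variables (U : 'M[k]_(b + a, b)) (V : 'M[k]_(b + a, a)) (X : 'M[k]_(b, a)).
Hypothesis K0_free : row_free K0.
Hypothesis KZ0 : forall i j, (combination top (row i K0) - combination low (row i Z0)).@[P0 j] = 0.
Hypothesis KZgen : forall u v, (forall j, (combination low u + combination top v).@[P0 j] = 0) ->
  exists c, u = - (c *m Z0) /\ v = c *m K0.
Hypothesis UV : U *m K0 + V *m W = 1%:M.
Hypothesis KV : K0 *m V = 0.
Hypothesis WV : W *m V = 1%:M.

Lemma chart_unit_at_points : chart_matrix low top W idfun P0 \in unitmx.
Proof.
rewrite -row_free_unit; apply: inj_row_free => c cM.
have [j|c' [uE vE]] := KZgen (u := lsubmx c) (v := rsubmx c *m W).
  by rewrite -chart_combination meval_chart cM mxE.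
have r0 : rsubmx c = 0 by rewrite -[LHS]mulmx1 -WV mulmxA vE -mulmxA KV mulmx0.
have c0 : c' = 0 by apply: (row_free_inj K0_free); rewrite -vE r0 !mul0mx.
by rewrite -(hsubmxK c) r0 uE c0 mul0mx oppr0 row_mx0.
Qed.

(** The hypothesis [unobstructed] of the lifting, from [points_unobstructed] applied to
    the combinations [\sum_i c i j *: f i] of the polynomials through the points. *)
Lemma points_tangent (c : 'I_b -> 'I_(L + a) -> k) :
  (forall i l, \sum_j c i j * mmap1 (P0 j) (low l) = 0) ->
  (forall j x, \sum_i c i j *
     ((combination top (row i K0) - combination low (row i Z0))^`M(x)).@[P0 j] = 0) ->
  forall i j, c i j = 0.
Proof.
move=> c_low c_der i j.
pose f i := combination top (row i K0) - combination low (row i Z0).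
pose g j := \sum_i c i j *: f i.
have g0 : forall j, g j = 0.
  apply: (points_unobstructed P0_general) => [{}j|{}j j'|h hs|{}j x].
  - apply: leq_trans (msize_sum _ _ _) _; apply/bigmax_leqP => i' _.
    apply: leq_trans (msizeZ_le _ _) _; apply: leq_trans (msizeD_le _ _) _.
    rewrite msizeN geq_max combination_top_size //=.
    by apply: leq_trans (combination_low_size _ _) _.
  - by rewrite raddf_sum big1 // => i' _; rewrite /= mevalZ KZ0 mulr0.
  - rewrite /g; under eq_bigr => j' _ do rewrite scaler_sumr.
    rewrite exchange_big big1 // => i' _ /=.
    under eq_bigr => j' _ do rewrite scalerA.
    rewrite -scaler_suml; suff -> : \sum_j' h.@[P0 j'] * c i' j' = 0 by rewrite scale0r.
    rewrite (low_expansion hs) /combination.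
    under eq_bigr => j' _ do rewrite raddf_sum mulr_suml /=.
    rewrite exchange_big big1 // => l _ /=; transitivity (coefs low h 0 l * \sum_j' c i' j' * mmap1 (P0 j') (low l)).
      by rewrite mulr_sumr; apply: eq_bigr => j' _; rewrite mevalZ /meval mmapX -mulrA [_ * c _ _]mulrC.
    by rewrite c_low mulr0.
  - rewrite /g (linear_sum (mderiv x)) raddf_sum /= -[RHS](c_der j x).
    by apply: eq_bigr => i' _; rewrite linearZ mevalZ.
have c0 : \row_i c i j = 0.
  apply: (row_free_inj K0_free); rewrite mul0mx; apply/rowP => q.
  transitivity ((g j)@_(top q)); last by rewrite g0 mcoeff0 mxE.
  rewrite -(combinationE _ top_inj) combination_mul /g !(raddf_sum (mcoeff (top q))) /=.
  apply: eq_bigr => i' _; rewrite mxE /= !mcoeffZ mcoeffB.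
  rewrite [X in _ - X]combination_out ?subr0 // low_codom.
  by have := top_codom (top q); rewrite codom_f => /esym /eqP ->; rewrite ltnn.
by have /rowP/(_ i) := c0; rewrite !mxE.
Qed.

Variable r : chart_fun k n (L + a).
Hypothesis smooth_zero : forall J : hilb k n (L + a), smooth_locus J ->
  basis_mod J (chart_basis low top W) -> chart_zero (chart_basis low top W) r J.

Let horner_const (t : k) p q (A : 'M[k]_(p, q)) : map_mx (horner_eval t) (map_mx polyC A) = A.
Proof. by apply/matrixP => i j; rewrite !mxE /horner_eval hornerC. Qed.

Let horner_monomials M (e : 'I_M -> 'X_{1..n}) (P : 'I_(L + a) -> 'I_n -> {poly k}) t :
  map_mx (horner_eval t) (monomials_at e P) = monomials_at e (fun j x => (P j x).[t]).
Proof.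
apply/matrixP => i j; rewrite !mxE /mmap1 /horner_eval horner_prod.
by apply: eq_bigr => x _; rewrite horner_exp.
Qed.

Let horner_chart (P : 'I_(L + a) -> 'I_n -> {poly k}) t :
  map_mx (horner_eval t) (chart_matrix low top W polyC P) =
  chart_matrix low top W idfun (fun j x => (P j x).[t]).
Proof.
by rewrite map_col_mx map_mxM !horner_monomials horner_const /chart_matrix map_mx_id.
Qed.

Let horner_cone (Y : 'M[{poly k}]_(b + a, a)) t :
  map_mx (horner_eval t) (cone_coordinates low top r polyC Y) =
  cone_coordinates low top r idfun (map_mx (horner_eval t) Y).
Proof.
rewrite /cone_coordinates map_row_mx map_mxM; congr row_mx.
  by apply/matrixP => i j; rewrite !mxE /horner_eval hornerC.
by congr mulmx; apply/matrixP => i j; rewrite !mxE /= /horner_eval hornerC.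
Qed.

Let mul_rsub (R : comNzRingType) p q m1 m2 (A : 'M[R]_(p, q)) (B : 'M_(q, m1 + m2)) :
  rsubmx (A *m B) = A *m rsubmx B.
Proof. by rewrite -{1}(hsubmxK B) mul_mx_row row_mxKr. Qed.

(** The matrix [V - U *m X] describes the degree [s] part of the ideal with forms
    [K0 + X W], and [V - t U X] that with forms [K0 + t X W].  Along the lifted curve
    of points the true coordinates agree with it up to order [t^(m+1)], and at the true
    coordinates [r] vanishes by [cone_zero]; so [r] on the line is divisible by
    every power of [t]. *)
Lemma cone_limit_zero :
  (cf_poly r).@[fun i => mxvec (cone_coordinates low top r idfun (V - U *m X)) 0 i] = 0.
Proof.
(* The coordinates along the line of forms [K0 + t X W]. *)
pose Yt := map_mx polyC V - 'X *: map_mx polyC (U *m X).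
pose u i := mxvec (cone_coordinates low top r polyC Yt) 0 i.
pose h := mmap polyC u (cf_poly r).
have uE t i : (u i).[t] = mxvec (cone_coordinates low top r idfun (map_mx (horner_eval t) Yt)) 0 i.
  by rewrite -horner_cone -map_mxvec [RHS]mxE.
suff h0 : h = 0.
  transitivity ((cf_poly r).@[fun i => (u i).[1]]); last by rewrite -horner_mmap -/h h0 horner0.
  apply: meval_eq => i; rewrite uE; congr (mxvec (cone_coordinates _ _ _ _ _) 0 i).
  by rewrite map_mxB map_mxZ !horner_const /= /horner_eval hornerX scale1r.
apply: dvdXn_all => -[|m]; first by rewrite expr0 dvd1p.
have [P [Z [P00 Z00 res]]] := curve_lift (X *m W) KZ0 points_tangent m.
pose Mt := chart_matrix low top W polyC P.
pose dt := \det Mt.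
have dtE t : dt.[t] = \det (chart_matrix low top W idfun (fun j x => (P j x).[t])).
  by rewrite -horner_chart det_map_mx.
(* The error of the lifted curve, and the cofactors that express the coordinates
   with denominator [dt]. *)
pose R := \matrix_(i, j) (residue low top K0 (X *m W) P Z i j %/ 'X^(m.+1)).
pose el := rsubmx (monomials_at low P *m \adj Mt).
pose et := rsubmx (monomials_at top P *m \adj Mt).
pose rt := rsubmx (R *m \adj Mt).
(* The chart basis has unit coordinates, up to the denominator [dt]. *)
have [el0 Wet] : el = 0 /\ map_mx polyC W *m et = dt%:M.
  have := mul_mx_adj Mt; rewrite {1}/Mt /chart_matrix mul_col_mx scalar_mx_block.
  move=> MM; split.
    by have := congr1 ursubmx MM; rewrite /ursubmx col_mxKu -/el -/(ursubmx _) block_mxKur.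
  have := congr1 drsubmx MM; rewrite /drsubmx col_mxKd -/(drsubmx _) block_mxKdr => <-.
  by rewrite /et -!mul_rsub mulmxA.
(* The forms [K0 + t X W] have coordinates zero, up to the error of the curve. *)
have Ket : map_mx polyC K0 *m et = - ('X *: (map_mx polyC X *m (map_mx polyC W *m et))) + 'X^(m.+1) *: rt.
  have -> : map_mx polyC K0 = map_mx polyC K0 + 'X *: map_mx polyC (X *m W) - 'X *: map_mx polyC (X *m W).
    by rewrite addrK.
  rewrite mulmxBl addrC; congr (_ + _); first by rewrite map_mxM -scalemxAl mulmxA.
  have -> : (map_mx polyC K0 + 'X *: map_mx polyC (X *m W)) *m et =
     rsubmx ((map_mx polyC K0 + 'X *: map_mx polyC (X *m W)) *m monomials_at top P *m \adj Mt).
    by rewrite -mulmxA mul_rsub.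
  have -> : (map_mx polyC K0 + 'X *: map_mx polyC (X *m W)) *m monomials_at top P =
      (\matrix_(i, l) Z i l) *m monomials_at low P + 'X^(m.+1) *: R.
    apply/matrixP => i j; rewrite !mxE mulrC divpK // /residue addrC -addrA.
    rewrite [Y in _ + (_ + Y)](_ : _ = \sum_l Z i l * mmap1 (P j) (low l)).
      by rewrite addNr addr0; apply: eq_bigr => q _; rewrite !mxE.
    by apply: eq_bigr => l _; rewrite !mxE.
  by rewrite mulmxDl linearD /= -mulmxA mul_rsub -/el el0 mulmx0 add0r -scalemxAl linearZ.
(* As [K0] and [W] are complementary, [Wet] and [Ket] determine the coordinates. *)
have etE : et = dt *: Yt + 'X^(m.+1) *: (map_mx polyC U *m rt).
  rewrite -[LHS]mul1mx -(map_mx1 polyC) -UV map_mxD !map_mxM mulmxDl -!mulmxA Ket Wet.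
  rewrite mulmxDr mulmxN -!scalemxAr /Yt scalerBr !mul_mx_scalar map_mxM.
  by rewrite -!scalemxAr [in X in _ = X + _]scalerA mulrC -scalerA addrC addrA.
pose F := \matrix_(x < cf_size r, q < b + a) ((cf_arg x)@_(top q))%:P.
pose v i := mxvec (row_mx (0 : 'M_(_, L)) (F *m (map_mx polyC U *m rt))) 0 i.
have dt0 : dt.[0] != 0.
  rewrite dtE -unitfE -unitmxE.
  suff -> : chart_matrix low top W idfun (fun j x => (P j x).[0]) = chart_matrix low top W idfun P0.
    exact: chart_unit_at_points.
  by congr col_mx; [|congr mulmx]; apply/matrixP => i j; rewrite !mxE; apply: mmap1_eq => x.
apply: (perturbation_dvd char0 (v := v) dt0) => t dtt.
have unit_t : chart_matrix low top W idfun (fun j x => (P j x).[t]) \in unitmx.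
  by rewrite unitmxE -dtE unitfE.
rewrite -[RHS](cone_zero char0 low_inj top_inj low_codom top_codom d_gt0 smooth_zero unit_t).
apply: meval_eq => i.
have -> : top_coordinates low top W (fun j x => (P j x).[t]) =
    map_mx (horner_eval t) Yt + (t ^+ m.+1 / dt.[t]) *: map_mx (horner_eval t) (map_mx polyC U *m rt).
  have := congr1 (map_mx (horner_eval t)) etE.
  rewrite map_mxD !map_mxZ /= /et map_rsubmx map_mxM map_mx_adj horner_monomials horner_chart.
  have -> : horner_eval t 'X^(m.+1) = t ^+ m.+1 by rewrite /horner_eval hornerXn.
  rewrite -[horner_eval t dt]/(dt.[t]) => E.
  rewrite /top_coordinates /invmx unit_t -scalemxAr linearZ /= E -dtE scalerDr scalerA mulVf // scale1r.
  by rewrite scalerA [_ * t ^+ _]mulrC.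
have -> A B c : cone_coordinates low top r idfun (A + c *: B) = cone_coordinates low top r idfun A +
    c *: row_mx 0 ((\matrix_(x < cf_size r, q < b + a) (cf_arg x)@_(top q)) *m B).
  rewrite /cone_coordinates scale_row_mx add_row_mx scaler0 addr0 mulmxDr -scalemxAr.
  by congr row_mx; congr (_ + _ *: (_ *m _)); apply/matrixP => x q; rewrite !mxE.
rewrite linearD linearZ /= mxE -uE; congr (_ + _).
rewrite [RHS]mxE mulrAC; congr (_ * _).
rewrite /v -[LHS]/(horner_eval t _).
have -> A : horner_eval t (mxvec A 0 i) = mxvec (map_mx (horner_eval t) A) 0 i by rewrite -map_mxvec [RHS]mxE.
rewrite map_row_mx map_mx0 map_mxM; congr (mxvec (row_mx _ (_ *m _)) _ _).
by apply/matrixP => x q; rewrite !mxE /= /horner_eval hornerC.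
Qed.

End Limit.

(** The given ideal is the point [t = 1] of the line [K0 + t X W], and its coordinates
    in the chart of [W] are those of [cone_limit_zero]. *)
Lemma smoothable_from_points : smoothable_component I.
Proof.
move=> Z Zclosed smoothZ.
have [Z0 [K0 [K0_free KZ0 KZgen]]] := ideal_of_points.
have [K1 [K1_free K1I]] := ideal_forms.
have [W /andP[u0 u1]] := common_complement char0 K0_free K1_free.
pose U := lsubmx (invmx (col_mx K0 W)); pose V := rsubmx (invmx (col_mx K0 W)).
have UV : U *m K0 + V *m W = 1%:M by rewrite -mul_row_col hsubmxK mulVmx.
have : col_mx K0 W *m row_mx U V = 1%:M by rewrite hsubmxK mulmxV.
rewrite mul_col_row scalar_mx_block => /eq_block_mx[_ KV _ WV].
(* In the decomposition of the space of forms as the sum of the spans of [K1] and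
   [W], the rows of [K0] are [A *m K1 - X *m W]. *)
pose A := lsubmx (K0 *m invmx (col_mx K1 W)); pose X := - rsubmx (K0 *m invmx (col_mx K1 W)).
have AX : A *m K1 = K0 + X *m W.
  rewrite mulNmx; apply/eqP; rewrite eq_sym subr_eq; apply/eqP.
  by rewrite -mul_row_col hsubmxK mulmxKV.
pose Y := V - U *m X.
have YW : 1%:M - Y *m W = U *m A *m K1.
  by rewrite -mulmxA AX mulmxDr -UV /Y mulmxBl mulmxA opprB addrA addrAC addrK.
(* Terms of degree greater than [s] lie in the ideal and do not count. *)
pose coord (f : T) : 'rV_(L + a) := row_mx (coefs low f) (coefs top f *m Y).
have coordP f : f - \sum_i coord f 0 i *: chart_basis low top W i \in hilb_ideal I.
  rewrite chart_combination row_mxKl row_mxKr.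
  have -> : f - (combination low (coefs low f) + combination top (coefs top f *m Y *m W)) =
    (f - combination low (coefs low f) - combination top (coefs top f)) +
    combination top (coefs top f *m (U *m A) *m K1).
    rewrite -(mulmxA _ (U *m A)) -YW (mulmxBr _ 1%:M) mulmx1 mulmxA combinationD combinationN opprD !addrA.
    by rewrite subrK.
  apply: rpredD (K1I _); set g := f - _ - _.
  rewrite (mpolyE g) rpred_sum // => m _; case: (leqP (mdeg m) s) => ms.
    by rewrite (tail_coef low_inj top_inj low_codom top_codom f ms) scale0r rpred0.
  exact/idealZ/I_lower/ideal_pow_monomial.
have [B' B'P] := hilb_colength I.
have BP : basis_mod I (chart_basis low top W).
  by apply: (spanning_basis B'P) => f; exists (coord f).
have [E EP] := Zclosed (chart_basis low top W).
apply/(EP I BP) => r Er C CP.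
have -> : C = cone_coordinates low top r idfun Y.
  apply/row_matrixP => x.
  have [c [_ c_uniq]] := BP (cf_arg x).
  have <- : c = row x C.
    by apply: c_uniq; under eq_bigr => j _ do rewrite mxE.
  rewrite (c_uniq (coord (cf_arg x))) // /coord /cone_coordinates row_row_mx row_mul.
  congr row_mx; last congr mulmx; by apply/rowP => i; rewrite !mxE.
have sz : forall J : hilb k n (L + a), smooth_locus J ->
    basis_mod J (chart_basis low top W) -> chart_zero (chart_basis low top W) r J.
  by move=> J sJ BJ; apply: (EP J BJ).1 => //; apply: smoothZ.
exact: (cone_limit_zero X K0_free KZ0 KZgen UV KV WV sz).
Qed.

End Smoothing.

Theorem smoothable_of_general_points (k : fieldType) (n s d : nat) (P : 'I_d -> 'I_n -> k) (I : hilb k n d) :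
  [pchar k] =i pred0 -> (0 < d)%N -> general_points s P ->
  (forall f, ideal_pow (@max_ideal k n) s.+1 f -> f \in hilb_ideal I) ->
  (forall f, f \in hilb_ideal I -> ideal_pow (@max_ideal k n) s f) ->
  smoothable_component I.
Proof.
move=> char0 d_gt0 gP Il Iu.
have [|L [low [low_inj low_codom]]] := @enumerate_monomials n (fun m => mdeg m < s)%N s.
  by move=> m /ltnW.
have [|N [top [top_inj top_codom]]] := @enumerate_monomials n (fun m => mdeg m == s) s.
  by move=> m /eqP ->.
have /andP[Ld dLN] := colength_bounds low_inj top_inj low_codom top_codom (hilb_colength I) Il Iu.
have dE : d = (L + (d - L))%N by rewrite subnKC.
have NE : N = (L + N - d + (d - L))%N.
  by rewrite addnBA // subnK // addKn.
move: (d - L)%N (L + N - d)%N dE NE => a b dE NE; subst d; subst N.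
exact: (smoothable_from_points char0 low_inj top_inj low_codom top_codom d_gt0 gP Il Iu).
Qed.

(** * Newton and Lagrange interpolation on the simplicial grid *)

Definition falling (R : comNzRingType) (x : R) (m : nat) : R := \prod_(i < m) (x - i%:R).

Lemma fallingS (R : comNzRingType) (x : R) m : falling x m.+1 = falling x m * (x - m%:R).
Proof. exact: big_ord_recr. Qed.

Lemma rmorph_falling (R S : comNzRingType) (h : {rmorphism R -> S}) x m :
  h (falling x m) = falling (h x) m.
Proof. by rewrite rmorph_prod; apply: eq_bigr => i _; rewrite rmorphB rmorph_nat. Qed.

Lemma falling_nat (R : comNzRingType) p m : falling p%:R m = (p ^_ m)%:R :> R.
Proof.
elim: m => [|m IH]; first by rewrite /falling big_ord0.
rewrite fallingS IH ffactnSr natrM; case: (leqP m p) => [mp|pm]; first by rewrite natrB.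
by rewrite ffact_small ?mul0r.
Qed.

Section Newton.
Variables (k : fieldType) (n : nat).
Hypothesis char0 : [pchar k] =i pred0.
Local Notation T := {mpoly k[n]}.

Lemma falling_nat_eq0 p m : (falling p%:R m == 0 :> k) = (p < m)%N.
Proof.
rewrite falling_nat ((pcharf0P k).1 char0).
by case: ltnP => [/ffact_small -> //|mp]; rewrite eqn0Ngt ffact_gt0 mp.
Qed.

(** The Newton basis for interpolation at the points with natural coordinates: its
    member [b] has leading form ['X_[b]] and vanishes at [grid m] unless [b <= m]. *)
Definition newton (b : 'X_{1..n}) : T := \prod_(x < n) falling 'X_x (b x).

Lemma meval_newton b (v : 'I_n -> k) : (newton b).@[v] = \prod_x falling (v x) (b x).
Proof.
rewrite rmorph_prod; apply: eq_bigr => x _.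
by rewrite [LHS](rmorph_falling (meval v)) /= mevalXU.
Qed.

Definition grid (m : 'X_{1..n}) : 'I_n -> k := fun x => (m x)%:R.

Lemma newton_grid b m : ((newton b).@[grid m] == 0) = ~~ [forall x, (b x <= m x)%N].
Proof.
rewrite meval_newton negb_forall.
apply/prodf_eq0/existsP => [[x _]|[x]]; first by rewrite falling_nat_eq0 => bm; exists x; rewrite -ltnNge.
by rewrite -ltnNge => bm; exists x; rewrite // falling_nat_eq0.
Qed.

Lemma le_mdeg_eq (b m : 'X_{1..n}) : [forall x, (b x <= m x)%N] -> (mdeg m <= mdeg b)%N -> b = m.
Proof.
move=> /forallP bm; rewrite !mdegE => le; apply/mnmP => x; apply/eqP.
have /leqif_sum : forall x : 'I_n, true -> (b x <= m x ?= iff (b x == m x))%N.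
  by move=> y _; split.
case=> le' eq'; move: eq'; rewrite eqn_leq le le' => /esym /forallP /(_ x).
by [].
Qed.

Lemma msizeM_leq (p q : T) : (msize (p * q) <= (msize p + msize q).-1)%N.
Proof.
have [->|p0] := eqVneq p 0; first by rewrite mul0r msize0.
by have [->|q0] := eqVneq q 0; rewrite ?mulr0 ?msize0 // msizeM.
Qed.

Let leads b (q : T) := (msize (q - 'X_[b]) <= mdeg b)%N.

Let leads_size b q : leads b q -> (msize q <= (mdeg b).+1)%N.
Proof.
move=> lq; rewrite -(subrK 'X_[b] q); apply: leq_trans (msizeD_le _ _) _.
by rewrite msizeX geq_max leqnn andbT; apply: leqW.
Qed.

Let leadsM b q b' q' : leads b q -> leads b' q' -> leads (b + b')%MM (q * q').
Proof.
move=> lq lq'; rewrite /leads mpolyXD.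
have -> : q * q' - 'X_[b] * 'X_[b'] = (q - 'X_[b]) * q' + 'X_[b] * (q' - 'X_[b']) by ring.
apply: leq_trans (msizeD_le _ _) _; rewrite geq_max mdegD; apply/andP; split.
  apply: leq_trans (msizeM_leq _ _) _; have := leads_size lq'; move: lq; rewrite /leads.
  move=> h1 h2; rewrite -subn1 leq_subLR add1n -addnS; exact: leq_add.
apply: leq_trans (msizeM_leq _ _) _; rewrite msizeX addSn /=.
by rewrite leq_add2l.
Qed.

Lemma newton_leads b : (msize (newton b - 'X_[b]) <= mdeg b)%N.
Proof.
rewrite -/(leads b _) /newton {1}(multinomUE_id b).
have leads0 : leads 0%MM 1 by rewrite /leads mpolyX0 subrr msize0.
apply: (big_ind2 leads) => // x _.
elim: (b x) => [|m IH]; first by rewrite mulm0n /falling big_ord0.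
rewrite mulmSr fallingS; apply: leadsM => //.
by rewrite /leads addrAC subrr sub0r msizeN -mpolyC_nat msizeC mdeg1; case: eqP.
Qed.

Lemma msize_newton b : (msize (newton b) <= (mdeg b).+1)%N.
Proof. exact/leads_size/newton_leads. Qed.

Section TopForms.
Variables (s N : nat) (top : 'I_N -> 'X_{1..n}).
Hypothesis top_inj : injective top.
Hypothesis top_codom : forall m, (m \in codom top) = (mdeg m == s).

Let mdeg_top t : mdeg (top t) = s.
Proof. by apply/eqP; rewrite -top_codom codom_f. Qed.

Lemma newton_remainder (h : T) : (msize h <= s.+1)%N ->
  (msize (h - \sum_t h@_(top t) *: newton (top t)) <= s)%N.
Proof.
move=> hs; rewrite (_ : h - _ = (h - \sum_t h@_(top t) *: 'X_[top t]) -
   \sum_t h@_(top t) *: (newton (top t) - 'X_[top t])); last first.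
  under [X in _ = _ - X]eq_bigr => t _ do rewrite scalerBr.
  by rewrite sumrB; ring.
apply: leq_trans (msizeD_le _ _) _; rewrite msizeN geq_max; apply/andP; split; last first.
  apply: leq_trans (msize_sum _ _ _) _; apply/bigmax_leqP => t _.
  by apply: leq_trans (msizeZ_le _ _) _; rewrite -[X in (_ <= X)%N](mdeg_top t) newton_leads.
rewrite msizeE; apply/bigmax_leqP_seq => m; rewrite mcoeff_msupp => hm _.
rewrite ltnNge; apply: contraNN hm => sm; rewrite mcoeffB.
move: sm; rewrite leq_eqVlt eq_sym => /orP[ms|ms].
  have : m \in codom top by rewrite top_codom.
  case/codomP => t ->; rewrite raddf_sum (bigD1 t) //= big1 => [|t' tt'].
    by rewrite mcoeffZ mcoeffX eqxx mulr1 addr0 subrr.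
  by rewrite mcoeffZ mcoeffX (inj_eq top_inj) (negPf tt') mulr0.
have /memN_msupp_eq0 -> : m \notin msupp h by apply: msize_mdeg_ge; apply: leq_trans ms.
rewrite raddf_sum big1 ?subr0 // => t _ /=; rewrite mcoeffZ mcoeffX.
by case: eqP => [e|_]; rewrite ?mulr0 //; move: ms; rewrite -e mdeg_top ltnn.
Qed.

Lemma newton_top_grid t m : (mdeg m < s)%N -> (newton (top t)).@[grid m] = 0.
Proof.
move=> ms; apply/eqP; rewrite newton_grid; apply/negP => le.
have e := le_mdeg_eq le; move: ms; rewrite -(mdeg_top t) => ms.
by move: (ms); rewrite (e (ltnW ms)) ltnn.
Qed.

End TopForms.

(** By induction on the degree: subtracting Newton polynomials removes the leading
    form without changing the values at grid points of smaller degree, and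
    the coefficients subtracted are the values at the grid points of top degree, up
    to nonzero factors. *)
Lemma grid_unisolvent s (h : T) : (msize h <= s)%N ->
  (forall m, (mdeg m < s)%N -> h.@[grid m] = 0) -> h = 0.
Proof.
elim: s h => [|s IH] h hs h0; first by apply/eqP; rewrite -msize_poly_eq0 -leqn0.
have [|N [top [top_inj top_codom]]] := @enumerate_monomials n (fun m => mdeg m == s) s.
  by move=> m /eqP ->.
have hE : h = \sum_t h@_(top t) *: newton (top t).
  apply/eqP; rewrite -subr_eq0; apply/eqP/IH; first exact: newton_remainder.
  move=> m ms; rewrite mevalB h0; last exact: ltnW.
  rewrite sub0r (raddf_sum (meval (grid m))) big1 ?oppr0 // => t _ /=.
  by rewrite mevalZ (newton_top_grid top_codom) ?mulr0.
rewrite hE big1 // => t _.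
have mdeg_top t' : mdeg (top t') = s by apply/eqP; rewrite -top_codom codom_f.
suff -> : h@_(top t) = 0 by rewrite scale0r.
have := h0 (top t); rewrite mdeg_top ltnSn => /(_ isT).
rewrite {1}hE (raddf_sum (meval _)) (bigD1 t) //= big1 => [|t' tt'].
  rewrite addr0 mevalZ => /eqP; rewrite mulf_eq0 newton_grid => /orP[/eqP //|].
  by case/negP; apply/forallP => x.
rewrite mevalZ (_ : (newton _).@[_] = 0) ?mulr0 //; apply/eqP; rewrite newton_grid.
by apply: contraNN tt' => le; apply/eqP/top_inj/(le_mdeg_eq le); rewrite !mdeg_top.
Qed.

(** The difference has degree less than [s] and vanishes on the grid. *)
Lemma newton_expansion s N (top : 'I_N -> 'X_{1..n}) (h : T) :
  injective top -> (forall m, (m \in codom top) = (mdeg m == s)) ->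
  (msize h <= s.+1)%N -> (forall m, (mdeg m < s)%N -> h.@[grid m] = 0) ->
  h = \sum_t h@_(top t) *: newton (top t).
Proof.
move=> top_inj top_codom hs h0; apply/eqP; rewrite -subr_eq0; apply/eqP.
apply: (@grid_unisolvent s); first exact: newton_remainder.
move=> m ms; rewrite mevalB h0 // sub0r (raddf_sum (meval (grid m))) big1 ?oppr0 // => t _ /=.
by rewrite mevalZ (newton_top_grid top_codom) ?mulr0.
Qed.

(** The Lagrange basis of the simplicial grid.  With the additional barycentric
    coordinate [s - 1 - \sum_x 'X_x] the grid is symmetric in [n + 1] coordinates of
    constant sum, and a product of falling factorials of total degree [s - 1]
    vanishes at all of its points but one. *)
Definition lagrange s (p : 'X_{1..n}) : T :=
  newton p * falling (s.-1%:R - \sum_x 'X_x) (s.-1 - mdeg p).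

Lemma meval_lagrange s p (v : 'I_n -> k) :
  (lagrange s p).@[v] = (\prod_x falling (v x) (p x)) * falling (s.-1%:R - \sum_x v x) (s.-1 - mdeg p).
Proof.
rewrite mevalM meval_newton; congr (_ * _).
rewrite [LHS](rmorph_falling (meval v)) /= rmorphB /= rmorph_nat (raddf_sum (meval v)) /=.
by under eq_bigr do rewrite mevalXU.
Qed.

Lemma lagrange_grid s p m : (mdeg p < s)%N -> (mdeg m < s)%N ->
  ((lagrange s p).@[grid m] == 0) = (m != p).
Proof.
move=> ps ms; rewrite meval_lagrange -meval_newton mulf_eq0 newton_grid.
have m_le : (mdeg m <= s.-1)%N by rewrite -ltnS prednK // (leq_ltn_trans _ ms).
have -> : s.-1%:R - \sum_x grid m x = (s.-1 - mdeg m)%:R :> k.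
  by rewrite natrB // mdegE natr_sum.
rewrite falling_nat_eq0; apply/idP/idP => [/orP[|lt]|mp].
- by apply: contraNneq => ->; apply/forallP.
- by apply: contraTneq lt => ->; rewrite ltnn.
- rewrite -implybE; apply/implyP => le.
  have lt : (mdeg p < mdeg m)%N.
    by rewrite ltnNge; apply: contraNN mp => /(le_mdeg_eq le) ->.
  by apply: ltn_sub2l => //; apply: leq_trans m_le.
Qed.

Lemma msize_lagrange s p : (mdeg p < s)%N -> (msize (lagrange s p) <= s)%N.
Proof.
move=> ps; set y : T := s.-1%:R - \sum_x 'X_x.
have ys : (msize y <= 2)%N.
  apply: leq_trans (msizeD_le _ _) _; rewrite msizeN geq_max -mpolyC_nat msizeC.
  apply/andP; split; first by case: eqP.
  apply: leq_trans (msize_sum _ _ _) _; apply/bigmax_leqP => x _.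
  by rewrite msizeX mdeg1.
have fs m : (msize (falling y m) <= m.+1)%N.
  elim: m => [|m IH]; first by rewrite /falling big_ord0 msize1.
  rewrite fallingS; apply: leq_trans (msizeM_leq _ _) _.
  have y2 : (msize (y - m%:R) <= 2)%N.
    apply: leq_trans (msizeD_le _ _) _; rewrite geq_max ys msizeN -mpolyC_nat msizeC.
    by case: eqP.
  by have := leq_add IH y2; rewrite addn2; case: (_ + _)%N.
apply: leq_trans (msizeM_leq _ _) _.
have := leq_add (msize_newton p) (fs (s.-1 - mdeg p)%N).
rewrite addnS addSn subnKC; last by rewrite -ltnS prednK // (leq_ltn_trans _ ps).
by rewrite prednK ?(leq_ltn_trans _ ps) //; case: (_ + _)%N.
Qed.

Section GridPoints.
Variables (s L N a : nat) (low : 'I_L -> 'X_{1..n}) (top : 'I_N -> 'X_{1..n}).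
Hypothesis low_inj : injective low.
Hypothesis top_inj : injective top.
Hypothesis low_codom : forall m, (m \in codom low) = (mdeg m < s)%N.
Hypothesis top_codom : forall m, (m \in codom top) = (mdeg m == s).
Variable q : 'I_a -> 'I_n -> k.

Definition grid_and (j : 'I_(L + a)) : 'I_n -> k :=
  match split j with inl l => grid (low l) | inr i => q i end.

Let grid_andl l : grid_and (lshift a l) = grid (low l).
Proof. by rewrite /grid_and split_lshift. Qed.

Let grid_andr i : grid_and (rshift L i) = q i.
Proof. by rewrite /grid_and split_rshift. Qed.

Hypothesis rank_condition : forall mu : 'I_a -> k,
  (forall t, \sum_i mu i * (newton (top t)).@[q i] = 0) -> forall i, mu i = 0.

Hypothesis tangent_condition : forall C : 'I_N -> 'I_a -> k,
  (forall l x, \sum_t \sum_i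
     C t i * (((newton (top t))^`M(x)).@[grid (low l)] * (lagrange s (low l)).@[q i]) = 0) ->
  (forall i x, \sum_t C t i * ((newton (top t))^`M(x)).@[q i] = 0) ->
  (forall i j, \sum_t C t i * (newton (top t)).@[q j] = 0) ->
  forall t i, C t i = 0.

Let mdeg_low l : (mdeg (low l) < s)%N.
Proof. by rewrite -low_codom codom_f. Qed.

Let mdeg_top t : mdeg (top t) = s.
Proof. by apply/eqP; rewrite -top_codom codom_f. Qed.

Let off_grid (h : T) : (forall l, h.@[grid (low l)] = 0) -> forall m, (mdeg m < s)%N -> h.@[grid m] = 0.
Proof. by move=> h0 m; rewrite -low_codom => /codomP[l ->]. Qed.

(** Testing a relation on the Lagrange polynomials expresses its coefficients at the
    grid points by those at the extra points. *)
Let lagrange_low (V : lmodType k) (g : 'I_(L + a) -> V) l :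
  \sum_j (lagrange s (low l)).@[grid_and j] *: g j =
  (lagrange s (low l)).@[grid (low l)] *: g (lshift a l) +
  \sum_i (lagrange s (low l)).@[q i] *: g (rshift L i).
Proof.
rewrite big_split_ord; congr (_ + _); last by apply: eq_bigr => i _; rewrite grid_andr.
rewrite (bigD1 l) //= grid_andl big1 ?addr0 // => l' l'l; rewrite grid_andl.
have /eqP -> : (lagrange s (low l)).@[grid (low l')] == 0.
  by rewrite lagrange_grid // (inj_eq low_inj).
by rewrite scale0r.
Qed.

Let lagrange_low_neq0 l : (lagrange s (low l)).@[grid (low l)] != 0.
Proof. by rewrite lagrange_grid // eqxx. Qed.

(** The relation tested on the Lagrange polynomials determines [g] at the grid points
    from [g] at the extra points, and the latter are combinations of Newton
    polynomials of degree [s]; [C] is the matrix of their coefficients.  The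
    remaining conditions on [g] become the three families of equations in
    [tangent_condition]. *)
Theorem grid_and_general : general_points s grid_and.
Proof.
split=> [h hs h0|mu mu0|g gs g0 g_rel g_der].
- by apply: (grid_unisolvent hs); apply: off_grid => l; rewrite -grid_andl.
(* The Newton polynomials of degree [s] see the extra points only, the Lagrange
   polynomials then see the grid points one at a time. *)
- have mur i : mu (rshift L i) = 0.
    apply: (rank_condition (mu := fun i => mu (rshift L i))) => t.
    have := mu0 (newton (top t)); rewrite -[X in (_ <= X.+1)%N](mdeg_top t) msize_newton => /(_ isT).
    rewrite big_split_ord /= big1 => [|l _]; last first.
      by rewrite grid_andl (newton_top_grid top_codom) ?mulr0.
    by rewrite add0r => E; rewrite -[RHS]E; apply: eq_bigr => i' _; rewrite grid_andr.
  move=> j; case: (split_ordP j) => [l|i] -> //.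
  have := mu0 (lagrange s (low l)) (leqW (msize_lagrange (mdeg_low l))).
  under eq_bigr => j' _ do rewrite mulrC.
  have := @lagrange_low k^o mu l; rewrite /GRing.scale /= => ->.
  rewrite [X in _ + X]big1 ?addr0 => [/eqP|i _]; last by rewrite mur mulr0.
  by rewrite mulf_eq0 (negPf (lagrange_low_neq0 l)) => /eqP.
- pose C t i := (g (rshift L i))@_(top t).
  have gE i : g (rshift L i) = \sum_t C t i *: newton (top t).
    by apply: newton_expansion => //; apply: off_grid => l; rewrite -grid_andl.
  have gl l : (lagrange s (low l)).@[grid (low l)] *: g (lshift a l) =
      - \sum_i (lagrange s (low l)).@[q i] *: g (rshift L i).
    apply/eqP; rewrite -addr_eq0 -lagrange_low; apply/eqP/g_rel/msize_lagrange.
    exact: mdeg_low.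
  have C0 : forall t i, C t i = 0.
    apply: tangent_condition => [l x|i x|i j].
    + have : ((lagrange s (low l)).@[grid (low l)] *: g (lshift a l))^`M(x).@[grid (low l)] = 0.
        by rewrite linearZ mevalZ -grid_andl g_der mulr0.
      rewrite gl linearN mevalN (linear_sum (mderiv x)) (raddf_sum (meval _)) /= => /eqP.
      rewrite oppr_eq0 => /eqP E; rewrite -[RHS]E exchange_big; apply: eq_bigr => i _ /=.
      rewrite linearZ mevalZ gE (linear_sum (mderiv x)) (raddf_sum (meval _)) mulr_sumr.
      by apply: eq_bigr => t _; rewrite /= linearZ mevalZ; ring.
    + have := g_der (rshift L i) x; rewrite grid_andr => E; rewrite -[RHS]E gE.
      rewrite (linear_sum (mderiv x)) (raddf_sum (meval _)).
      by apply: eq_bigr => t _; rewrite /= linearZ mevalZ.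
    + have := g0 (rshift L i) (rshift L j); rewrite grid_andr => E; rewrite -[RHS]E gE.
      by rewrite (raddf_sum (meval _)); apply: eq_bigr => t _; rewrite /= mevalZ.
  have gr i : g (rshift L i) = 0 by rewrite gE big1 // => t _; rewrite C0 scale0r.
  move=> j; case: (split_ordP j) => [l|i] -> //.
  apply/eqP; have /eqP := gl l; rewrite big1 ?oppr0 => [|i _]; last by rewrite gr scaler0.
  by rewrite scaler_eq0 (negPf (lagrange_low_neq0 l)).
Qed.

End GridPoints.

End Newton.

Local Close Scope ring_scope.

(** * The linear systems and their elimination modulo 31 *)

Section System.
Variables (T : Type) (zero one : T) (add mul : T -> T -> T) (opp : T -> T).

(** The equations are written over arbitrary operations: they have to be compared over
    the integers, over the base field and over the residues modulo 31, and the last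
    ones must be computed without any algebraic structure in the way. *)
Definition scalar (n : nat) : T := iter n (add one) zero.
Definition sub x y := add x (opp y).

(** The falling factorials of [x] paired with their derivatives with respect to [x],
    starting from the value [f] and the derivative [d] of the one of degree [c]. *)
Fixpoint fallings (x c f d : T) (m : nat) : seq (T * T) :=
  (f, d) :: if m is m'.+1
            then fallings x (add c one) (mul f (sub x c)) (add (mul d (sub x c)) f) m'
            else [::].

Definition exponents (s : nat) : seq (nat * nat * nat) :=
  flatten [seq [seq (i, j, (s - i - j)%N) | j <- iota 0 (s - i).+1] | i <- iota 0 s.+1].

Definition exponents_lt (s : nat) := flatten [seq exponents e | e <- iota 0 s].

Definition table := (seq (T * T) * seq (T * T) * seq (T * T))%type.

Definition table_of (s : nat) (v : T * T * T) : table :=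
  let: (x, y, z) := v in
  (fallings x zero one zero s, fallings y zero one zero s, fallings z zero one zero s).

Definition value (t : table) (b : nat * nat * nat) : T :=
  let: (tx, ty, tz) := t in let: (i, j, k) := b in
  mul (mul (nth (zero, zero) tx i).1 (nth (zero, zero) ty j).1) (nth (zero, zero) tz k).1.

Definition deriv (l : nat) (t : table) (b : nat * nat * nat) : T :=
  let: (tx, ty, tz) := t in let: (i, j, k) := b in
  let X := nth (zero, zero) tx i in let Y := nth (zero, zero) ty j in
  let Z := nth (zero, zero) tz k in
  match l with
  | 0 => mul (mul X.2 Y.1) Z.1
  | 1 => mul (mul X.1 Y.2) Z.1
  | _ => mul (mul X.1 Y.1) Z.2
  end.

Definition point (b : nat * nat * nat) : T * T * T :=
  let: (i, j, k) := b in (scalar i, scalar j, scalar k).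

Definition degree (b : nat * nat * nat) : nat := let: (i, j, k) := b in (i + j + k)%N.

(** The falling factorials of the additional barycentric coordinate, which occur in
    the Lagrange polynomials of the grid. *)
Definition barycentric (s : nat) (v : T * T * T) : seq (T * T) :=
  let: (x, y, z) := v in
  fallings (sub (scalar s.-1) (add (add x y) z)) zero one zero s.

Definition unit_vector (a i : nat) : seq T := [seq if j == i then one else zero | j <- iota 0 a].

(** The equations of [tangent_condition] in [grid_and_general].  Each of them has rank
    one: a pair of a vector indexed by the monomials of degree [s] and a vector
    indexed by the extra points stands for their tensor product. *)
Definition tangent_system (s : nat) (qs : seq (nat * nat * nat)) : seq (seq T * seq T) :=
  let top := exponents s in
  let a := size qs in
  let tabs := [seq (table_of s (point q), barycentric s (point q)) | q <- qs] in
  flatten [seq (let t := table_of s (point p) in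
                let lam := [seq mul (value tr.1 p) (nth (zero, zero) tr.2 (s.-1 - degree p)).1 | tr <- tabs] in
                [seq ([seq deriv l t b | b <- top], lam) | l <- iota 0 3])
          | p <- exponents_lt s] ++
  flatten [seq (let t := (nth (table_of s (zero, zero, zero), [::]) tabs i).1 in
                [seq ([seq deriv l t b | b <- top], unit_vector a i) | l <- iota 0 3])
          | i <- iota 0 a] ++
  flatten [seq [seq ([seq value tr.1 b | b <- top], unit_vector a i) | i <- iota 0 a] | tr <- tabs].

(** The equations of [rank_condition] in [grid_and_general], with one unknown for each
    extra point. *)
Definition rank_system (s : nat) (qs : seq (nat * nat * nat)) : seq (seq T * seq T) :=
  let tabs := [seq table_of s (point q) | q <- qs] in
  [seq ([:: one], [seq value t b | t <- tabs]) | b <- exponents s].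
End System.

(** Residues modulo 31 as a bare enumeration: each operation is a nested case analysis
    on constructors, which the kernel reduces in a few steps. *)
Inductive F31 : Set := a0 | a1 | a2 | a3 | a4 | a5 | a6 | a7 | a8 | a9 | a10 | a11 | a12 | a13 | a14
    | a15 | a16 | a17 | a18 | a19 | a20 | a21 | a22 | a23 | a24 | a25 | a26 | a27 | a28 | a29 | a30.

Definition decode (x : F31) : nat := match x with a0 => 0 | a1 => 1 | a2 => 2 | a3 => 3 | a4 => 4 |
    a5 => 5 | a6 => 6 | a7 => 7 | a8 => 8 | a9 => 9 | a10 => 10 | a11 => 11 | a12 => 12 | a13 => 13
    | a14 => 14 | a15 => 15 | a16 => 16 | a17 => 17 | a18 => 18 | a19 => 19 | a20 => 20 | a21 => 21
    | a22 => 22 | a23 => 23 | a24 => 24 | a25 => 25 | a26 => 26 | a27 => 27 | a28 => 28 | a29 => 29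
    | a30 => 30 end.
Definition code (n : nat) : F31 := nth a0 [:: a0; a1; a2; a3; a4; a5; a6; a7; a8; a9; a10; a11; a12;
    a13; a14; a15; a16; a17; a18; a19; a20; a21; a22; a23; a24; a25; a26; a27; a28; a29; a30] (n %%
    31).

Definition tabulate (T : Type) (f : F31 -> T) (x : F31) : T :=
match x with a0 => f a0 | a1 => f a1 | a2 => f a2 | a3 => f a3 | a4 => f a4 | a5 => f a5 | a6 => f
    a6 | a7 => f a7 | a8 => f a8 | a9 => f a9 | a10 => f a10 | a11 => f a11 | a12 => f a12 | a13 =>
    f a13 | a14 => f a14 | a15 => f a15 | a16 => f a16 | a17 => f a17 | a18 => f a18 | a19 => f a19
    | a20 => f a20 | a21 => f a21 | a22 => f a22 | a23 => f a23 | a24 => f a24 | a25 => f a25 | a26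
    => f a26 | a27 => f a27 | a28 => f a28 | a29 => f a29 | a30 => f a30 end.

Definition add31 : F31 -> F31 -> F31 := Eval vm_compute in
  tabulate (fun x => tabulate (fun y => code (decode x + decode y))).
Definition mul31 : F31 -> F31 -> F31 := Eval vm_compute in
  tabulate (fun x => tabulate (fun y => code (decode x * decode y))).
Definition opp31 : F31 -> F31 := Eval vm_compute in tabulate (fun x => code (31 - decode x)).
Definition inv31 : F31 -> F31 := Eval vm_compute in
  tabulate (fun x => code (find (fun n => decode (mul31 x (code n)) == 1) (iota 0 31))).

Definition is0 (x : F31) : bool := if x is a0 then true else false.

(** A linear form in unknowns with two indices, as the list of its rows of
    coefficients; missing rows and missing entries are zero. *)
Definition form := seq (seq F31).

Fixpoint axpy (c : F31) (u v : seq F31) : seq F31 :=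
  match u, v with
  | [::], _ => v
  | _, [::] => [seq mul31 c x | x <- u]
  | x :: u', y :: v' => add31 (mul31 c x) y :: axpy c u' v'
  end.

Fixpoint form_axpy (c : F31) (r t : form) : form :=
  match r, t with
  | [::], _ => t
  | _, [::] => [seq [seq mul31 c x | x <- u] | u <- r]
  | u :: r', v :: t' => axpy c u v :: form_axpy c r' t'
  end.

(** One step of elimination of the first unknown, with pivot row [u :: r] and [z] the
    opposite of the inverse of the pivot; the column of the eliminated unknown is
    dropped. *)
Definition reduce (z : F31) (u : seq F31) (r row : form) : form :=
  match row with
  | (y :: w) :: t =>
    if is0 y then w :: t
    else let c := mul31 y z in axpy c u w :: form_axpy c r t
  | _ => row
  end.

(** The result [None] means that the first unknown occurs in no equation, so that it is
    not determined. *)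
Fixpoint pivot (rows : seq form) : option (seq form) :=
  match rows with
  | [::] => None
  | row :: rows' =>
    match row with
    | (x :: u) :: r =>
      if is0 x then option_map (cons (u :: r)) (pivot rows')
      else let z := opp31 (inv31 x) in Some [seq reduce z u r row | row <- rows']
    | _ => option_map (cons row) (pivot rows')
    end
  end.

Fixpoint pivots (a : nat) (rows : seq form) : option (seq form) :=
  if a is a'.+1 then
    match pivot rows with None => None | Some rows' => pivots a' rows' end
  else Some [seq behead row | row <- rows].

Fixpoint solve (n a : nat) (rows : seq form) : bool :=
  if n is n'.+1 then
    match pivots a rows with None => false | Some rows' => solve n' a rows' end
  else true.

(** Rows that vanish are stored as empty lists, or not at all at the end, which keeps the
    equations sparse. *)
Fixpoint tensor (g lam : seq F31) : form :=
  match g with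
  | [::] => [::]
  | x :: g' =>
    let r := tensor g' lam in
    if is0 x then (if r is [::] then [::] else [::] :: r)
    else [seq mul31 x y | y <- lam] :: r
  end.

(** Sorting the equations by their number of rows reduces the fill-in of the
    elimination.  Equations with more than 40 rows would be left out, which could only
    make the system weaker. *)
Definition rows_of (sys : seq (seq F31 * seq F31)) : seq form :=
  let rows := [seq tensor gl.1 gl.2 | gl <- sys & ~~ all is0 gl.2] in
  flatten [seq [seq r | r <- rows & size r == i] | i <- iota 1 40].

Definition check_tangent s qs :=
  solve (size (exponents s)) (size qs) (rows_of (tangent_system a0 a1 add31 mul31 opp31 s qs)).
Definition check_rank s qs :=
  solve 1 (size qs) (rows_of (rank_system a0 a1 add31 mul31 opp31 s qs)).

Local Open Scope ring_scope.

(** * From residues to characteristic zero *)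

Section Transfer.
Variables (k : fieldType) (p : nat).
Hypothesis char0 : [pchar k] =i pred0.

(** A left inverse modulo [p], lifted to the integers, gives a square integer matrix
    whose determinant is 1 modulo [p].  The determinant is a nonzero integer, hence
    a unit in characteristic zero. *)
Lemma injective_transfer m n (A : 'M[int]_(m, n)) :
  (forall v : 'cV['F_p]_n, map_mx intr A *m v = 0 -> v = 0) ->
  forall v : 'cV[k]_n, map_mx intr A *m v = 0 -> v = 0.
Proof.
move=> inj v Av.
have /row_freeP[B AB] : row_free (map_mx intr A : 'M['F_p]_(m, n))^T.
  apply: inj_row_free => u uA; apply: trmx_inj; rewrite trmx0; apply: inj.
  by apply: trmx_inj; rewrite trmx_mul trmxK uA trmx0.
(* Representatives of the residues in the left inverse. *)
pose B' : 'M[int]_(n, m) := \matrix_(i, j) (B^T i j : nat)%:Z.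
have BE : map_mx intr B' = B^T.
  by apply/matrixP => i j; rewrite !mxE -pmulrn natr_Zp.
have D0 : \det (B' *m A) != 0.
  have : (\det (B' *m A))%:~R = 1 :> 'F_p.
    rewrite -det_map_mx map_mxM BE -[X in _ *m X]trmxK -trmx_mul AB trmx1.
    exact: det1.
  by apply: contra_eqN => /eqP ->; rewrite eq_sym oner_eq0.
have : map_mx intr (B' *m A) *m v = 0 by rewrite map_mxM -mulmxA Av mulmx0.
have u : map_mx intr (B' *m A) \in (unitmx : {pred 'M[k]_n}).
  rewrite unitmxE det_map_mx unitfE.
  have := (pcharf0P k).1 char0 `|\det (B' *m A)|%N; rewrite absz_eq0 (negPf D0) => /negbT.
  by case: (intP (\det _)) => [|d|d] //=; rewrite ?abszN ?absz_nat ?mulrNz ?oppr_eq0 -pmulrn.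
by move/(congr1 (mulmx (invmx (map_mx intr (B' *m A))))); rewrite mulKmx // mulmx0.
Qed.

Definition kills (R : comNzRingType) (N a : nat) (sys : seq (seq R * seq R)) (c : 'I_N -> 'I_a -> R) :=
  forall r, (r < size sys)%N ->
  \sum_(t < N) \sum_(i < a) nth 0 (nth ([::], [::]) sys r).1 t * nth 0 (nth ([::], [::]) sys r).2 i * c t i = 0.

Definition map_system (S T : Type) (h : S -> T) (sys : seq (seq S * seq S)) : seq (seq T * seq T) :=
  [seq (map h gl.1, map h gl.2) | gl <- sys].

Lemma nth_map0 (S T : Type) (h : S -> T) x s i : nth (h x) (map h s) i = h (nth x s i).
Proof.
by case: (ltnP i (size s)) => is_; [rewrite (nth_map x) | rewrite !nth_default ?size_map].
Qed.

Lemma system_transfer N a (sys : seq (seq int * seq int)) :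
  (forall c : 'I_N -> 'I_a -> 'F_p, kills (map_system intr sys) c -> forall t i, c t i = 0) ->
  forall c : 'I_N -> 'I_a -> k, kills (map_system intr sys) c -> forall t i, c t i = 0.
Proof.
move=> inj c cK.
pose ev (x : 'I_#|{: 'I_N * 'I_a}|) : 'I_N * 'I_a := enum_val x.
pose A : 'M[int]_(size sys, #|{: 'I_N * 'I_a}|) := \matrix_(r, x)
  (nth 0 (nth ([::], [::]) sys r).1 (ev x).1 * nth 0 (nth ([::], [::]) sys r).2 (ev x).2).
have AE (R : comNzRingType) (e : 'I_N -> 'I_a -> R) :
    kills (map_system intr sys) e <-> map_mx intr A *m \col_x e (ev x).1 (ev x).2 = 0.
  have rowE (r : 'I_(size sys)) : (map_mx intr A *m \col_x e (ev x).1 (ev x).2) r 0 =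
      \sum_(t < N) \sum_(i < a) nth 0 (nth ([::], [::]) (map_system intr sys) r).1 t *
        nth 0 (nth ([::], [::]) (map_system intr sys) r).2 i * e t i.
    pose G (u : 'I_N * 'I_a) := nth 0 (nth ([::], [::]) (map_system intr sys) r).1 u.1 *
        nth 0 (nth ([::], [::]) (map_system intr sys) r).2 u.2 * e u.1 u.2.
    transitivity (\sum_u G u); last exact: sum_pair.
    rewrite mxE [RHS]sum_enum_val; apply: eq_bigr => x _; rewrite !mxE /G -/(ev x).
    by rewrite (nth_map ([::], [::])) //= intrM -!(nth_map0 intr).
  split=> [eK|eA r]; first by apply/colP => r; rewrite rowE mxE eK // size_map.
  rewrite size_map => rs; have := rowE (Ordinal rs); rewrite eA mxE => E0.
  exact: esym.
have injA : forall v : 'cV['F_p]_#|{: 'I_N * 'I_a}|, map_mx intr A *m v = 0 -> v = 0.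
  move=> v Av; apply/colP => x; rewrite mxE.
  rewrite -(enum_valK x); case: (enum_val x) => t i.
  apply: (inj (fun t i => v (enum_rank (t, i)) 0)); apply/AE; rewrite -[RHS]Av.
  congr (_ *m _); apply/colP => y; rewrite mxE -surjective_pairing.
  by rewrite /ev enum_valK.
move=> t i; have /AE/(injective_transfer injA)/colP/(_ (enum_rank (t, i))) := cK.
by rewrite !mxE /ev enum_rankK.
Qed.

End Transfer.

(** * Soundness of the elimination *)

Definition embed (x : F31) : 'F_31 := (decode x)%:R.

Lemma decode_add x y : decode (add31 x y) = ((decode x + decode y) %% 31)%N.
Proof. by case: x; case: y. Qed.

Lemma decode_mul x y : decode (mul31 x y) = ((decode x * decode y) %% 31)%N.
Proof. by case: x; case: y. Qed.

Lemma embed_mod n : (n %% 31)%:R = n%:R :> 'F_31.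
Proof. exact: (@Zp_nat_mod 31). Qed.

Lemma embed_add x y : embed (add31 x y) = embed x + embed y.
Proof. by rewrite /embed decode_add embed_mod natrD. Qed.

Lemma embed_mul x y : embed (mul31 x y) = embed x * embed y.
Proof. by rewrite /embed decode_mul embed_mod natrM. Qed.

Lemma embed_opp x : embed (opp31 x) = - embed x.
Proof. by apply/eqP; rewrite -addr_eq0 -embed_add; case: x. Qed.

(** Unknowns are functions on all natural numbers, so that missing coefficients and the
    shift of indices in the elimination need no bounds. *)
Fixpoint block_eval (u : seq F31) (v : nat -> 'F_31) : 'F_31 :=
  if u is x :: u' then embed x * v 0%N + block_eval u' (fun i => v i.+1) else 0.

Fixpoint form_eval (r : form) (v : nat -> nat -> 'F_31) : 'F_31 :=
  if r is u :: r' then block_eval u (v 0%N) + form_eval r' (fun j => v j.+1) else 0.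

Lemma block_eval_scale c u v : block_eval [seq mul31 c x | x <- u] v = embed c * block_eval u v.
Proof. by elim: u v => [|x u IH] v /=; rewrite ?mulr0 // IH embed_mul; ring. Qed.

Lemma block_eval_axpy c u w v : block_eval (axpy c u w) v = embed c * block_eval u v + block_eval w v.
Proof.
elim: u w v => [|x u IH] [|y w] v /=; rewrite ?mulr0 ?add0r ?addr0 //.
  by rewrite block_eval_scale embed_mul; ring.
by rewrite IH embed_add embed_mul; ring.
Qed.

Lemma form_eval_scale c r v :
  form_eval [seq [seq mul31 c x | x <- u] | u <- r] v = embed c * form_eval r v.
Proof. by elim: r v => [|u r IH] v /=; rewrite ?mulr0 // IH block_eval_scale; ring. Qed.

Lemma form_eval_axpy c r t v : form_eval (form_axpy c r t) v = embed c * form_eval r v + form_eval t v.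
Proof.
elim: r t v => [|u r IH] [|w t] v /=; rewrite ?mulr0 ?add0r ?addr0 //.
  by rewrite form_eval_scale block_eval_scale; ring.
by rewrite IH block_eval_axpy; ring.
Qed.

(** The unknowns that are left after the elimination of the first unknown of the
    first row. *)
Definition shift (v : nat -> nat -> 'F_31) : nat -> nat -> 'F_31 :=
  fun j i => if j is 0 then v 0%N i.+1 else v j i.

Local Notation vanish v rows := (all (fun r => form_eval r v == 0) rows).

Lemma block_eval0 u v : (forall i, v i = 0) -> block_eval u v = 0.
Proof. by elim: u v => //= x u IH v v0; rewrite v0 mulr0 add0r IH. Qed.

Lemma form_eval0 r v : (forall j i, v j i = 0) -> form_eval r v = 0.
Proof. by elim: r v => //= u r IH v v0; rewrite block_eval0 // add0r IH. Qed.

Lemma embed_is0 x : is0 x -> embed x = 0.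
Proof. by case: x. Qed.

Lemma embed_inv x : ~~ is0 x -> embed x * embed (inv31 x) = 1.
Proof. by rewrite -embed_mul; case: x. Qed.

Lemma reduce_eval x u r row v : ~~ is0 x -> embed x * v 0%N 0%N + form_eval (u :: r) (shift v) = 0 ->
  form_eval row v = 0 -> form_eval (reduce (opp31 (inv31 x)) u r row) (shift v) = 0.
Proof.
move=> x0 xE; case: row => [|[|y w] t] //= rowE.
case: ifP => [/embed_is0 y0|_]; first by move: rowE => /=; rewrite y0 mul0r add0r.
move: xE rowE; rewrite /= block_eval_axpy form_eval_axpy embed_mul embed_opp.
set u0 := block_eval u _; set r0 := form_eval r _.
set w0 := block_eval w _; set t0 := form_eval t _ => xE rowE.
have {}rowE : embed y * v 0%N 0%N + w0 + t0 = 0 := rowE.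
transitivity (embed y * v 0%N 0%N + w0 + t0
  - embed y * embed (inv31 x) * (embed x * v 0%N 0%N + (u0 + r0))); last by rewrite rowE xE mulr0 subr0.
have -> : embed y * embed (inv31 x) * (embed x * v 0%N 0%N + (u0 + r0)) =
    embed y * (embed x * embed (inv31 x)) * v 0%N 0%N + embed y * embed (inv31 x) * (u0 + r0) by ring.
by rewrite embed_inv //; ring.
Qed.

(** The reduced equations hold for the remaining unknowns, and the pivot equation gives
    the eliminated one. *)
Lemma pivot_sound v rows rows' : pivot rows = Some rows' -> vanish v rows ->
  vanish (shift v) rows' /\ ((forall j i, shift v j i = 0) -> v 0%N 0%N = 0).
Proof.
elim: rows rows' => [|row rows IH] rows' //=.
case: row => [|[|x u] r] /=.
- case E: (pivot rows) => [rows1|] //= [<-] vr; exact: IH E vr.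
- case E: (pivot rows) => [rows1|] //= [<-] /andP[e vr] /=; have [h1 h2] := IH _ E vr.
  by rewrite e.
case: ifP => x0.
  case E: (pivot rows) => [rows1|] //= [<-] /andP[e vr] /=; have [h1 h2] := IH _ E vr.
  by move: e; rewrite (embed_is0 x0) mul0r add0r => ->.
case=> <- /andP[/eqP e vr]; split=> [|v0].
  rewrite all_map; apply: sub_all vr => row /eqP rowE /=; apply/eqP.
  by apply: (reduce_eval (negbT x0)) => //; rewrite -[RHS]e /= addrA.
move: e; have := form_eval0 (u :: r) v0 => /= e0; rewrite -addrA e0 addr0 => e.
by rewrite -[LHS]mul1r -(embed_inv (negbT x0)) mulrAC e mul0r.
Qed.

Lemma pivots_sound a v rows rows' : pivots a rows = Some rows' -> vanish v rows ->
  (forall i, (a <= i)%N -> v 0%N i = 0) ->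
  vanish (fun j => v j.+1) rows' /\ ((forall j i, v j.+1 i = 0) -> forall i, v 0%N i = 0).
Proof.
elim: a v rows => [|a IH] v rows /=.
  case=> <- vr v0; split=> [|_ i]; last exact: v0.
  rewrite all_map; apply: sub_all vr => -[|u r] //= e.
  by move: e; rewrite block_eval0 ?add0r // => i; apply: v0.
case E: (pivot rows) => [rows1|] // E' vr v0; have [vr1 v00] := pivot_sound E vr.
have [|vr' v0'] := IH (shift v) rows1 E' vr1; first by move=> i ai; apply: v0.
split=> // vS; have vS0 : forall i, v 0%N i.+1 = 0 by apply: v0'.
by case=> //; apply: v00 => -[|j] i; [apply: vS0|apply: vS].
Qed.

Lemma solve_sound n a v rows : solve n a rows -> vanish v rows ->
  (forall j i, ~~ ((j < n) && (i < a))%N -> v j i = 0) -> forall j i, v j i = 0.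
Proof.
elim: n v rows => [|n IH] v rows /=; first by move=> _ _ v0 j i; apply: v0.
case E: (pivots a rows) => [rows1|] // E' vr v0.
have [|vr1 v00] := pivots_sound E vr; first by move=> i ai; apply: v0; rewrite negb_and -!leqNgt ai orbT.
have vS : forall j i, v j.+1 i = 0 by apply: (IH (fun j => v j.+1) rows1) => // j i ji; apply: v0.
by case=> [|j] i; [apply: v00|].
Qed.

Lemma block_eval_sum a u v : (forall i, (a <= i)%N -> v i = 0) ->
  block_eval u v = \sum_(i < a) nth 0 (map embed u) i * v i.
Proof.
elim: a u v => [|a IH] u v v0; first by rewrite big_ord0 block_eval0 // => i; apply: v0.
case: u => [|x u] /=; first by rewrite big1 // => i _; rewrite nth_nil mul0r.
by rewrite big_ord_recl (IH u) // => i ai; apply: v0.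
Qed.

Lemma tensor_eval n a g lam v : (forall j i, ~~ ((j < n) && (i < a))%N -> v j i = 0) ->
  form_eval (tensor g lam) v =
  \sum_(t < n) \sum_(i < a) nth 0 (map embed g) t * nth 0 (map embed lam) i * v t i.
Proof.
elim: n g v => [|n IH] g v v0.
  by rewrite big_ord0 form_eval0 // => j i; apply: v0.
case: g => [|x g] /=.
  rewrite big1 // => t _; rewrite big1 // => i _; by rewrite nth_nil !mul0r.
have v0' i : (a <= i)%N -> v 0%N i = 0 by move=> ai; apply: v0; rewrite negb_and -!leqNgt ai orbT.
have E : form_eval (tensor g lam) (fun j => v j.+1) =
  \sum_(t < n) \sum_(i < a) nth 0 (map embed g) t * nth 0 (map embed lam) i * v t.+1 i.
  by apply: IH => j i ji; apply: v0.
rewrite big_ord_recl -E /=; case: ifP => x0.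
  rewrite (embed_is0 x0) big1 ?add0r => [|i _]; last by rewrite !mul0r.
  by case: (tensor g lam) => [|u r] //=; rewrite add0r.
rewrite /= block_eval_scale (block_eval_sum _ v0') mulr_sumr; congr (_ + _).
by apply: eq_bigr => i _; rewrite mulrA.
Qed.

Lemma all_filter_sub (T : Type) (p q : pred T) s : all p s -> all p (filter q s).
Proof. by elim: s => //= x s IH /andP[px /IH]; case: ifP => //= _; rewrite px. Qed.

Lemma check_sound n a sys (c : 'I_n -> 'I_a -> 'F_31) : solve n a (rows_of sys) ->
  kills (map_system embed sys) c -> forall t i, c t i = 0.
Proof.
(* Extended by zero outside the ranges of the two indices. *)
move=> ok cK; pose v (t i : nat) := match insub t, insub i with Some t', Some i' => c t' i' | _, _ => 0 end.
have vE (t : 'I_n) (i : 'I_a) : v t i = c t i by rewrite /v !valK.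
have v0 j i : ~~ ((j < n) && (i < a))%N -> v j i = 0.
  by rewrite /v; case: insubP => [t jn _|//]; case: insubP => [i' ia _|//]; rewrite jn ia.
have vanish_sys : all (fun gl => form_eval (tensor gl.1 gl.2) v == 0) sys.
  apply/(all_nthP ([::], [::])) => r rs; rewrite (tensor_eval _ _ v0).
  have := cK r; rewrite size_map => /(_ rs); rewrite (nth_map ([::], [::])) //= => E.
  by apply/eqP; rewrite -[RHS]E; apply: eq_bigr => t _; apply: eq_bigr => i _; rewrite vE.
have : all (fun r => form_eval r v == 0) (rows_of sys).
  rewrite /rows_of; set rows := [seq tensor gl.1 gl.2 | gl <- sys & _].
  have rows_ok : all (fun r => form_eval r v == 0) rows by rewrite all_map; apply: all_filter_sub.
  by elim: (iota 1 40) => //= i l IH; rewrite all_cat IH map_id all_filter_sub.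
by move=> /(solve_sound ok) => vz t i; rewrite -vE; apply: vz v0 _ _.
Qed.

(** * Naturality of the systems *)

Section Morphism.
Variables (T T' : Type) (z o : T) (ad mu : T -> T -> T) (op : T -> T).
Variables (z' o' : T') (ad' mu' : T' -> T' -> T') (op' : T' -> T').
Variable h : T -> T'.
Hypothesis h0 : h z = z'.
Hypothesis h1 : h o = o'.
Hypothesis hD : forall x y, h (ad x y) = ad' (h x) (h y).
Hypothesis hM : forall x y, h (mu x y) = mu' (h x) (h y).
Hypothesis hN : forall x, h (op x) = op' (h x).

Let hh (p : T * T) := (h p.1, h p.2).
Let h3 (v : T * T * T) := (h v.1.1, h v.1.2, h v.2).
Let ht (t : table T) : table T' := (map hh t.1.1, map hh t.1.2, map hh t.2).

Let h_scalar n : h (scalar z o ad n) = scalar z' o' ad' n.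
Proof. by elim: n => //= n IH; rewrite hD h1 IH. Qed.

Let h_fallings x c f d m :
  map hh (fallings o ad mu op x c f d m) = fallings o' ad' mu' op' (h x) (h c) (h f) (h d) m.
Proof.
elim: m c f d => [|m IH] c f d //=; rewrite IH /sub; congr (_ :: _).
by rewrite !hD !hM !hD hN h1.
Qed.

Let nth_hh s i : nth (z', z') (map hh s) i = hh (nth (z, z) s i).
Proof. by rewrite -(nth_map0 hh) /hh /= h0. Qed.

Let h_value t b : h (value z mu t b) = value z' mu' (ht t) b.
Proof. by case: t b => [[tx ty] tz] [[i j] l] /=; rewrite !hM !nth_hh. Qed.

Let h_deriv l t b : h (deriv z mu l t b) = deriv z' mu' l (ht t) b.
Proof. by case: t b l => [[tx ty] tz] [[i j] m] [|[|l]] /=; rewrite !hM !nth_hh. Qed.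

Let h_table s v : ht (table_of z o ad mu op s v) = table_of z' o' ad' mu' op' s (h3 v).
Proof. by case: v => [[x y] w]; rewrite /ht /= !h_fallings h0 h1. Qed.

Let h_rest s v : map hh (barycentric z o ad mu op s v) = barycentric z' o' ad' mu' op' s (h3 v).
Proof.
by case: v => [[x y] w]; rewrite /barycentric h_fallings h0 h1 /sub !hD hN !hD h_scalar.
Qed.

Let h_point b : h3 (point z o ad b) = point z' o' ad' b.
Proof. by case: b => [[i j] l]; rewrite /h3 /= !h_scalar. Qed.

Let h_unit a i : map h (unit_vector z o a i) = unit_vector z' o' a i.
Proof. by rewrite -map_comp; apply: eq_map => j /=; case: eqP. Qed.

(** The coefficients are built from the ring operations, so they are compatible with
    every map that preserves these operations. *)
Lemma map_tangent_system s qs :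
  map_system h (tangent_system z o ad mu op s qs) = tangent_system z' o' ad' mu' op' s qs.
Proof.
pose tab q := (table_of z o ad mu op s (point z o ad q), barycentric z o ad mu op s (point z o ad q)).
pose tab' q := (table_of z' o' ad' mu' op' s (point z' o' ad' q), barycentric z' o' ad' mu' op' s (point z' o' ad' q)).
have tabE q : tab' q = (ht (tab q).1, map hh (tab q).2) by rewrite /tab /= h_table h_rest h_point.
rewrite /tangent_system -/tab -/tab' /map_system; move: tab tab' tabE (exponents s) => tab tab' tabE top.
rewrite map_cat; congr (_ ++ _).
  rewrite map_flatten -map_comp; congr flatten; apply: eq_map => p /=.
  have lamE : [seq h i | i <- [seq mu (value z mu tr.1 p) (nth (z, z) tr.2 (s.-1 - degree p)).1 | tr <- map tab qs]] =
      [seq mu' (value z' mu' tr.1 p) (nth (z', z') tr.2 (s.-1 - degree p)).1 | tr <- map tab' qs].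
    by rewrite -!map_comp; apply: eq_map => q /=; rewrite tabE hM h_value nth_hh.
  by rewrite lamE -h_point -h_table; congr [:: (_, _); (_, _); (_, _)]; rewrite -map_comp; apply: eq_map => b /=; rewrite h_deriv.
rewrite map_cat; congr (_ ++ _).
  rewrite map_flatten -map_comp; congr flatten; apply: eq_map => i /=.
  set t := (nth _ (map tab qs) i).1; set t' := (nth _ (map tab' qs) i).1.
  have -> : t' = ht t.
    rewrite /t /t'; have -> : map tab' qs = map (fun tr => (ht tr.1, map hh tr.2)) (map tab qs).
      by rewrite -map_comp; apply: eq_map => q; rewrite tabE.
    have -> : (table_of z' o' ad' mu' op' s (z', z', z'), [::]) =
        (fun tr : table T * seq (T * T) => (ht tr.1, map hh tr.2)) (table_of z o ad mu op s (z, z, z), [::]).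
      have e : h3 (z, z, z) = (z', z', z') by rewrite /h3 /= h0.
      by rewrite -e -h_table.
    by rewrite nth_map0.
  by congr [:: (_, _); (_, _); (_, _)]; rewrite ?h_unit // -map_comp; apply: eq_map => b /=; rewrite h_deriv.
rewrite map_flatten -!map_comp; congr flatten; apply: eq_map => q /=.
rewrite -map_comp; apply: eq_map => i /=; rewrite h_unit -map_comp; congr (_, _).
by apply: eq_map => b /=; rewrite h_value tabE.
Qed.

Lemma map_rank_system s qs :
  map_system h (rank_system z o ad mu op s qs) = rank_system z' o' ad' mu' op' s qs.
Proof.
rewrite /rank_system /map_system; move: (exponents s) => top; rewrite -map_comp; apply: eq_map => b /=; rewrite h1 -!map_comp.
by congr (_, _); apply: eq_map => q /=; rewrite h_value h_table h_point.
Qed.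

End Morphism.

(** * The systems over the base field *)

Section RingSystem.
Variable R : comNzRingType.

(** The derivative of [falling] by the product rule, in the same recursive form as in
    [fallings]. *)
Fixpoint dfalling (x : R) (m : nat) : R :=
  if m is m'.+1 then dfalling x m' * (x - m'%:R) + falling x m' else 0.

Lemma scalar_ring m : scalar 0 1 +%R m = m%:R :> R.
Proof. by elim: m => //= m ->; rewrite mulrS. Qed.

Lemma nth_fallings x c m i : (i <= m)%N ->
  nth (0, 0) (fallings 1 +%R *%R -%R x c%:R (falling x c) (dfalling x c) m) i =
  (falling x (c + i), dfalling x (c + i)).
Proof.
elim: m c i => [|m IH] c [|i] //=; rewrite ?addn0 // ltnS => im.
have := IH c.+1 i im; rewrite addSnnS -addn1 natrD addn1 /= fallingS => <-.
by rewrite /sub.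
Qed.

Lemma nth_fallings0 x m i : (i <= m)%N ->
  nth (0, 0) (fallings 1 +%R *%R -%R x 0 1 0 m) i = (falling x i, dfalling x i).
Proof.
by move=> im; have := nth_fallings x 0 im; rewrite /falling big_ord0 /=.
Qed.

End RingSystem.

Lemma rmorph_dfalling (R S : comNzRingType) (h : {rmorphism R -> S}) x m : h (dfalling x m) = dfalling (h x) m.
Proof.
elim: m => [|m IH] /=; first by rewrite rmorph0.
by rewrite rmorphD rmorphM rmorphB rmorph_nat IH rmorph_falling.
Qed.

Lemma mderiv_falling (k : comNzRingType) n (l x : 'I_n) m :
  (falling ('X_x : {mpoly k[n]}) m)^`M(l) = if l == x then dfalling 'X_x m else 0.
Proof.
elim: m => [|m IH] /=.
  by rewrite /falling big_ord0 -mpolyC1 mderivC; case: eqP.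
rewrite fallingS mderivM IH mderivB -mpolyC_nat mderivC subr0 mpolyC_nat.
have -> : ('X_x : {mpoly k[n]})^`M(l) = (l == x)%:R.
  rewrite mderivX mnm1E eq_sym; case: eqP => [->|_]; rewrite ?scale0r //.
  have -> : ((U_(x) - U_(x))%MM = 0%MM :> 'X_{1..n}) by apply/mnmP => j; rewrite mnmBE mnm0E subnn.
  by rewrite mpolyX0 scale1r.
by case: eqP; rewrite ?mulr1 // mul0r mulr0 addr0.
Qed.

Definition exponent (b : nat * nat * nat) : 'X_{1..3} :=
  [multinom nth 0%N [:: b.1.1; b.1.2; b.2] x | x < 3].

Lemma mdeg_exponent b : mdeg (exponent b) = degree b.
Proof.
case: b => [[i j] l]; rewrite mdegE !big_ord_recl big_ord0 !mnmE /=.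
by rewrite addn0 addnA.
Qed.

Lemma exponent_inj : injective exponent.
Proof.
move=> [[i j] l] [[i' j'] l'] /mnmP e.
have := e (inord 0); have := e (inord 1); have := e (inord 2).
by rewrite !mnmE !inordK //= => -> -> ->.
Qed.

Lemma exponent_surj m : exists b, m = exponent b.
Proof.
exists (m (inord 0), m (inord 1), m (inord 2)); apply/mnmP => x; rewrite mnmE /=.
by case: x => -[|[|[|x]]] //= hx; congr (m _); apply: val_inj; rewrite /= inordK.
Qed.

Lemma mem_exponents s b : (b \in exponents s) = (degree b == s).
Proof.
apply/allpairsPdep/eqP => [[i [j [hi hj ->]]]|].
  move: hi hj; rewrite !mem_iota !add0n !ltnS /= => hi hj.
  by rewrite /= -addnA (subnKC hj) subnKC.
case: b => [[i j] l] <-; exists i, j; rewrite -[degree _]/(i + j + l)%N -addnA !mem_iota !ltnS.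
by rewrite !addKn !leq_addr.
Qed.

Lemma uniq_exponents s : uniq (exponents s).
Proof.
apply: allpairs_uniq_dep => [|i _|[i j] [i' j'] _ _ /= []]; rewrite ?iota_uniq //.
by move=> -> ->.
Qed.

Lemma mem_exponents_lt s b : (b \in exponents_lt s) = (degree b < s)%N.
Proof.
apply/flatten_mapP/idP => [[e]|bs]; first by rewrite mem_iota mem_exponents => es /eqP ->.
by exists (degree b); rewrite ?mem_iota ?mem_exponents.
Qed.

Lemma uniq_exponents_lt s : uniq (exponents_lt s).
Proof.
elim: s => // s IH; rewrite /exponents_lt -addn1 iotaD map_cat flatten_cat cat_uniq.
rewrite -/(exponents_lt s) IH [flatten [seq _ | _ <- iota _ 1]]/= cats0 add0n uniq_exponents andbT.
apply/hasPn => b; rewrite mem_exponents => /eqP bs.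
by rewrite mem_exponents_lt bs ltnn.
Qed.

Lemma enumerates (s : seq (nat * nat * nat)) (Q : pred 'X_{1..3}) : uniq s ->
  (forall b, (b \in s) = Q (exponent b)) ->
  let e := fun t : 'I_(size s) => exponent (nth (0, 0, 0)%N s t) in
  injective e /\ forall m, (m \in codom e) = Q m.
Proof.
move=> us sQ /=; split=> [t t' /exponent_inj /eqP|m].
  by rewrite nth_uniq // => /eqP /val_inj.
have [b ->] := exponent_surj m; rewrite -sQ; apply/codomP/idP => [[t /exponent_inj ->]|bs].
  exact: mem_nth.
have bs' : (index b s < size s)%N by rewrite index_mem.
by exists (Ordinal bs'); rewrite /= nth_index.
Qed.

Lemma enumerates_low s :
  let e := fun t : 'I_(size (exponents_lt s)) => exponent (nth (0, 0, 0)%N (exponents_lt s) t) in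
  injective e /\ forall m, (m \in codom e) = (mdeg m < s)%N.
Proof.
apply: (enumerates (Q := fun m => mdeg m < s)%N (uniq_exponents_lt s)) => b.
by rewrite mem_exponents_lt mdeg_exponent.
Qed.

Lemma enumerates_top s :
  let e := fun t : 'I_(size (exponents s)) => exponent (nth (0, 0, 0)%N (exponents s) t) in
  injective e /\ forall m, (m \in codom e) = (mdeg m == s).
Proof.
apply: (enumerates (Q := fun m => mdeg m == s) (uniq_exponents s)) => b.
by rewrite mem_exponents mdeg_exponent.
Qed.

Section OverField.
Variable k : fieldType.
Hypothesis char0 : [pchar k] =i pred0.
Variable s : nat.

Local Notation tab q := (table_of 0 1 +%R *%R -%R s (point (0 : k) 1 +%R q)).

Lemma newton3 (b : nat * nat * nat) : newton k (exponent b) =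
  falling 'X_0 b.1.1 * falling 'X_1 b.1.2 * falling 'X_2%:R b.2.
Proof.
rewrite /newton !big_ord_recl big_ord0 mulr1 mulrA !mnmE /=.
by do 2?congr (_ * _); congr (falling 'X_ _ _); apply: val_inj.
Qed.

Let grid_exponent q (x : 'I_3) : grid k (exponent q) x = (nth 0%N [:: q.1.1; q.1.2; q.2] x)%:R.
Proof. by rewrite /grid mnmE. Qed.

Let meval_falling v (x : 'I_3) m : (falling 'X_x m : {mpoly k[3]}).@[v] = falling (v x) m.
Proof. by rewrite [LHS](rmorph_falling (meval v)) /= mevalXU. Qed.

Let meval_dfalling v (x : 'I_3) m : (dfalling 'X_x m : {mpoly k[3]}).@[v] = dfalling (v x) m.
Proof. by rewrite [LHS](rmorph_dfalling (meval v)) /= mevalXU. Qed.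

Let degree_le b : (degree b <= s)%N -> [/\ b.1.1 <= s, b.1.2 <= s & b.2 <= s]%N.
Proof.
case: b => [[i j] l] /= bs; split; apply: leq_trans bs; rewrite -addnA ?leq_addr //.
  by rewrite addnCA leq_addr.
by rewrite addnA leq_addl.
Qed.

Lemma value_newton q b : (degree b <= s)%N ->
  value 0 *%R (tab q) b = (newton k (exponent b)).@[grid k (exponent q)].
Proof.
move=> bs; rewrite newton3 !mevalM !meval_falling !grid_exponent /=.
have [hi hj hl] := degree_le bs.
by case: q b bs hi hj hl => [[x y] z] [[i j] l] /= _ hi hj hl; rewrite !scalar_ring !nth_fallings0.
Qed.

Lemma deriv_newton q b (l : 'I_3) : (degree b <= s)%N ->
  deriv 0 *%R l (tab q) b = (newton k (exponent b))^`M(l).@[grid k (exponent q)].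
Proof.
move=> bs; rewrite newton3 !mderivM !mderiv_falling.
have [hi hj hm] := degree_le bs.
case: q b bs hi hj hm => [[x y] z] [[i j] m] /= _ hi hj hm; rewrite !scalar_ring !nth_fallings0 //.
case: l => -[|[|[|l]]] //= hl;
  by rewrite ?(mul0r, mulr0, add0r, addr0) !mevalM ?meval_dfalling ?meval_falling !grid_exponent.
Qed.

Lemma lagrange_value q p : (degree p < s)%N ->
  value 0 *%R (tab q) p * (nth (0, 0) (barycentric 0 1 +%R *%R -%R s (point (0 : k) 1 +%R q)) (s.-1 - degree p)).1 =
  (lagrange k s (exponent p)).@[grid k (exponent q)].
Proof.
move=> ps; rewrite meval_lagrange -meval_newton value_newton; last exact: ltnW.
rewrite mdeg_exponent; congr (_ * _); rewrite !big_ord_recl big_ord0 !grid_exponent addr0.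
case: q => [[x y] z]; rewrite /barycentric [point _ _ _ _]/=.
rewrite nth_fallings0; last by apply: leq_trans (leq_subr _ _) (leq_pred _).
by rewrite /= !scalar_ring /sub addrA.
Qed.

End OverField.

Lemma system_injective (k : fieldType) N a (sysF : seq (seq F31 * seq F31)) (sysZ : seq (seq int * seq int)) :
  [pchar k] =i pred0 ->
  map_system embed sysF = map_system intr sysZ -> solve N a (rows_of sysF) ->
  forall c : 'I_N -> 'I_a -> k, kills (map_system intr sysZ) c -> forall t i, c t i = 0.
Proof.
move=> char0 E ok; apply: (@system_transfer k 31 char0) => c.
by rewrite -E; apply: check_sound.
Qed.

Lemma killsP (R : comNzRingType) N a (sys : seq (seq R * seq R)) (c : 'I_N -> 'I_a -> R) :
  (forall gl, gl \in sys -> \sum_(t < N) \sum_(i < a) nth 0 gl.1 t * nth 0 gl.2 i * c t i = 0) -> kills sys c.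
Proof. by move=> h r rs; apply: h; apply: mem_nth. Qed.

Section Certificate.
Variable k : fieldType.
Hypothesis char0 : [pchar k] =i pred0.
Variables (s : nat) (qs : seq (nat * nat * nat)).
Hypothesis rank_ok : check_rank s qs.
Hypothesis tangent_ok : check_tangent s qs.

Let z0 : nat * nat * nat := (0, 0, 0)%N.
Let q (i : 'I_(size qs)) : 'I_3 -> k := grid k (exponent (nth z0 qs i)).
Let top (t : 'I_(size (exponents s))) := exponent (nth z0 (exponents s) t).
Let low (t : 'I_(size (exponents_lt s))) := exponent (nth z0 (exponents_lt s) t).

Let degree_top (t : 'I_(size (exponents s))) : (degree (nth z0 (exponents s) t) <= s)%N.
Proof. by have := mem_nth z0 (ltn_ord t); rewrite mem_exponents => /eqP ->. Qed.

Let map_ring (R : comNzRingType) m qs' : map_system intr (tangent_system (0 : int) 1 +%R *%R -%R m qs') =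
  tangent_system (0 : R) 1 +%R *%R -%R m qs'.
Proof.
apply: map_tangent_system; [exact: rmorph0|exact: rmorph1|exact: rmorphD|exact: rmorphM|exact: rmorphN].
Qed.

Let map_ring_rank (R : comNzRingType) m qs' : map_system intr (rank_system (0 : int) 1 +%R *%R -%R m qs') =
  rank_system (0 : R) 1 +%R *%R -%R m qs'.
Proof.
apply: map_rank_system; [exact: rmorph0|exact: rmorph1|exact: rmorphD|exact: rmorphM|exact: rmorphN].
Qed.

Let embed0 : embed a0 = 0. Proof. by []. Qed.
Let embed1 : embed a1 = 1. Proof. by []. Qed.

Let tangent_injective (c : 'I_(size (exponents s)) -> 'I_(size qs) -> k) :
  kills (tangent_system (0 : k) 1 +%R *%R -%R s qs) c -> forall t i, c t i = 0.
Proof.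
rewrite -map_ring; apply: (system_injective char0 _ tangent_ok); rewrite map_ring.
exact: (map_tangent_system embed0 embed1 embed_add embed_mul embed_opp).
Qed.

Let rank_injective (c : 'I_1 -> 'I_(size qs) -> k) :
  kills (rank_system (0 : k) 1 +%R *%R -%R s qs) c -> forall t i, c t i = 0.
Proof.
rewrite -map_ring_rank; apply: (system_injective char0 _ rank_ok); rewrite map_ring_rank.
exact: (map_rank_system embed0 embed1 embed_add embed_mul embed_opp).
Qed.

Let nth_map_qs (V : nmodType) (F : nat * nat * nat -> V) (i : 'I_(size qs)) :
  nth 0 [seq F x | x <- qs] i = F (nth z0 qs i).
Proof. by rewrite (nth_map z0). Qed.

Let nth_unit (i j : 'I_(size qs)) : nth 0 (unit_vector (0 : k) 1 (size qs) i) j = (j == i)%:R.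
Proof.
rewrite (nth_map 0%N) ?size_iota // nth_iota // add0n -[j == i]/(j == i :> nat).
by case: eqP.
Qed.

Let sum_unit (G : 'I_(size (exponents s)) -> k) (c : 'I_(size (exponents s)) -> 'I_(size qs) -> k) i :
  \sum_t c t i * G t = 0 ->
  \sum_t \sum_(j < size qs) G t * (nth 0 (unit_vector (0 : k) 1 (size qs) i) j) * c t j = 0.
Proof.
move=> cG; rewrite -[RHS]cG; apply: eq_bigr => t _; rewrite (bigD1 i) //= big1 => [|j ji].
  by rewrite nth_unit eqxx mulr1 addr0 mulrC.
by rewrite nth_unit (negPf ji) mulr0 mul0r.
Qed.

Let nth_map_top (V : nmodType) (F : nat * nat * nat -> V) (t : 'I_(size (exponents s))) :
  nth 0 [seq F b | b <- exponents s] t = F (nth z0 (exponents s) t).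
Proof. exact: nth_map. Qed.

Let top_sum (F : 'X_{1..3} -> k) : (forall t, F (top t) = 0) ->
  forall b, b \in exponents s -> F (exponent b) = 0.
Proof. by move=> F0 b /(nthP z0)[t ts <-]; apply: (F0 (Ordinal ts)). Qed.

Let low_sum (F : 'X_{1..3} -> k) : (forall l, F (low l) = 0) ->
  forall b, b \in exponents_lt s -> F (exponent b) = 0.
Proof. by move=> F0 b /(nthP z0)[t ts <-]; apply: (F0 (Ordinal ts)). Qed.

(** The integer systems, reduced modulo 31, are those that have been solved; mapped to
    the field [k], they are the equations required by [grid_and_general]. *)
Theorem certified_points :
  exists P : 'I_(size (exponents_lt s) + size qs) -> 'I_3 -> k, general_points s P.
Proof.
have [low_inj low_codom] := enumerates_low s.
have [top_inj top_codom] := enumerates_top s.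
exists (grid_and low q).
apply: (grid_and_general char0 low_inj top_inj low_codom top_codom) => [mu mu0 i|C E1 E2 E3].
  apply: (@rank_injective (fun _ => mu) _ ord0 i); apply: killsP => _ /mapP[b bs ->].
  rewrite big_ord1 -[RHS](@top_sum (fun m => \sum_i mu i * (newton k m).@[q i]) mu0 b bs); apply: eq_bigr => j _.
  rewrite -map_comp [nth 0 (fst _) _]/= mul1r mulrC; congr (_ * _).
  rewrite [snd _]/= nth_map_qs; apply: value_newton => //.
  by move: bs; rewrite mem_exponents => /eqP ->.
apply: tangent_injective; apply: killsP => gl; rewrite !mem_cat => /or3P[].
- case/flatten_mapP => p ps /mapP[l ls ->] {gl}.
  have l3 : (l < 3)%N by move: ls; rewrite mem_iota.
  rewrite -[l]/(nat_of_ord (Ordinal l3)) /fst /snd.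
  rewrite -[RHS](@low_sum (fun m => \sum_t \sum_i C t i *
     (((newton k (top t))^`M(Ordinal l3)).@[grid k m] * (lagrange k s m).@[q i])) (E1 ^~ (Ordinal l3)) p ps) {E1 E2 E3 ls}.
  apply: eq_bigr => t _; apply: eq_bigr => i _; rewrite mulrC; congr (_ * (_ * _)).
    by rewrite nth_map_top; apply: deriv_newton => //; apply: degree_top.
  rewrite -map_comp nth_map_qs; apply: lagrange_value => //.
  by move: ps; rewrite mem_exponents_lt.
- case/flatten_mapP => i; rewrite mem_iota add0n => /andP[_ is_] /mapP[l ls ->] {gl}.
  have l3 : (l < 3)%N by move: ls; rewrite mem_iota.
  rewrite -[l]/(nat_of_ord (Ordinal l3)) -[i]/(nat_of_ord (Ordinal is_)) /fst /snd.
  apply: sum_unit; rewrite -[RHS](E2 (Ordinal is_) (Ordinal l3)); apply: eq_bigr => t _; congr (_ * _).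
  rewrite nth_map_top (nth_map z0) //; apply: deriv_newton => //; exact: degree_top.
- case/flatten_mapP => tr /(nthP (table_of 0 1 +%R *%R -%R s (0,0,0), [::]))[j].
  rewrite size_map => js <- {tr} /mapP[i]; rewrite mem_iota add0n => /andP[_ is_] -> {gl}.
  rewrite -[i]/(nat_of_ord (Ordinal is_)) /fst /snd.
  apply: sum_unit; rewrite -[RHS](E3 (Ordinal is_) (Ordinal js)); apply: eq_bigr => t _; congr (_ * _).
  rewrite nth_map_top (nth_map z0) //; apply: value_newton => //; exact: degree_top.
Qed.

End Certificate.

(** * Certificates and conclusion *)

Section Data.
Local Open Scope nat_scope.

Definition squares (b : nat * nat * nat) : nat :=
  let: (i, j, l) := b in i * i + j * j + l * l.

(** The extra points are mostly grid points of degree [s], taken from the centre of the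
    simplex outwards. *)
Definition central (s : nat) : seq (nat * nat * nat) :=
  sort (fun b c => squares b <= squares c) (exponents s).

(** Points in no special position with respect to the grid; with grid points of degree
    [s] alone some of the systems are singular modulo 31. *)
Definition sporadic : seq (nat * nat * nat) :=
  [:: (7, 9, 3); (23, 12, 15); (0, 12, 17); (4, 2, 2); (29, 9, 25); (24, 1, 7); (16, 17, 11); (8, 24, 5)].

(** The entry with indices [s] and [a] is the number of sporadic points among the [a]
    extra points: the smallest number for which the systems are injective
    modulo 31. *)
Definition sporadic_count : seq (seq nat) :=
  [:: [:: 0; 0];
      [:: 0; 0; 0; 0];
      [:: 0; 0; 0; 0; 0; 0; 0];
      [:: 0; 0; 1; 1; 2; 1; 1; 0; 0; 0; 0];
      [:: 0; 1; 1; 1; 1; 2; 3; 3; 3; 2; 2; 2; 0; 0; 0; 0];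
      [:: 0; 1; 2; 2; 2; 3; 4; 5; 6; 3; 4; 5; 5; 5; 4; 4; 4; 2; 0; 0; 0; 0];
      [:: 0; 1; 2; 3; 3; 4; 5; 6; 6; 6; 7; 8; 8; 8; 7; 8; 6; 6; 7; 6; 6; 6; 5; 5; 2; 0; 0; 0; 0];
      [:: 0; 1; 2; 3; 4; 5; 6; 6; 6; 6; 7; 8]].

Definition extra_points (s a : nat) : seq (nat * nat * nat) :=
  let f := nth 0 (nth [::] sporadic_count s) a in take (a - f) (central s) ++ take f sporadic.

Definition certificate (s : nat) : bool :=
  all (fun a => let qs := extra_points s a in [&& size qs == a, check_rank s qs & check_tangent s qs])
      (iota 0 (size (nth [::] sporadic_count s))).

Lemma certificate0 : certificate 0. Proof. by vm_compute. Qed.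
Lemma certificate1 : certificate 1. Proof. by vm_compute. Qed.
Lemma certificate2 : certificate 2. Proof. by vm_compute. Qed.
Lemma certificate3 : certificate 3. Proof. by vm_compute. Qed.
Lemma certificate4 : certificate 4. Proof. by vm_compute. Qed.
Lemma certificate5 : certificate 5. Proof. by vm_compute. Qed.
Lemma certificate6 : certificate 6. Proof. by vm_compute. Qed.
Lemma certificate7 : certificate 7. Proof. by vm_compute. Qed.

(** The bound 95 leaves [s <= 7], as there are 120 monomials of degree less than 8. *)
Lemma certificates s a : size (exponents_lt s) + a <= 95 -> a <= size (exponents s) ->
  exists qs, [/\ size qs = a, check_rank s qs & check_tangent s qs].
Proof.
move=> La aN; have s8 : s < 8.
  rewrite ltnNge; apply/negP => s8.
  have : size (exponents_lt 8) <= 95.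
    apply: leq_trans (leq_trans (leq_addr a _) La); apply: uniq_leq_size => [|b].
      exact: uniq_exponents_lt.
    by rewrite !mem_exponents_lt => /leq_trans; apply.
  by have -> : size (exponents_lt 8) = 120 by vm_compute.
have a_lt : a < size (nth [::] sporadic_count s).
  have : all (fun s => minn (95 - size (exponents_lt s)) (size (exponents s)) <
                       size (nth [::] sporadic_count s)) (iota 0 8) by vm_compute.
  move/allP/(_ s); rewrite mem_iota => /(_ s8); apply: leq_ltn_trans.
  by rewrite leq_min aN andbT leq_subRL // (leq_trans (leq_addr a _)).
have : certificate s.
  case: s s8 {La aN a_lt} => [|[|[|[|[|[|[|[|s]]]]]]]] s8;
  [exact: certificate0|exact: certificate1|exact: certificate2|exact: certificate3
  |exact: certificate4|exact: certificate5|exact: certificate6|exact: certificate7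
  |exact: (False_ind _ (notF s8))].
move/allP/(_ a); rewrite mem_iota add0n => /(_ a_lt) /and3P[/eqP sz rk tg].
by exists (extra_points s a).
Qed.

End Data.

Theorem proposition5p3 (k : closedFieldType) (char0 : [pchar k]%R =i pred0)
    (d : nat) (hd : (0 < d <= 95)%N) (I : hilb k 3 d) :
  very_compressed I -> smoothable_component I.
Proof.
case/andP: hd => d_gt0 d95 [s [I_lower I_upper]].
have [low_inj low_codom] := enumerates_low s.
have [top_inj top_codom] := enumerates_top s.
have /andP[Ld dLN] := colength_bounds low_inj top_inj low_codom top_codom (hilb_colength I) I_lower I_upper.
have [||qs [qs_size rank_ok tangent_ok]] := @certificates s (d - size (exponents_lt s)).
- by rewrite subnKC.
- by rewrite leq_subLR.
have [P P_general] := certified_points char0 rank_ok tangent_ok.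
have dE : d = (size (exponents_lt s) + size qs)%N by rewrite qs_size subnKC.
move: P P_general; rewrite -dE => P P_general.
exact: (smoothable_of_general_points char0 d_gt0 P_general I_lower I_upper).
Qed.
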